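(* Let $\Sigma^n$ be a connected orientable minimal hypersurface properly immersed in $\mathbb{R}^{n+1}$. Assume that $|x^\perp|$ is bounded on $\Sigma$. Then $\Sigma$ has polynomial volume growth.
   Context: Hypersurfaces are smooth, without boundary, with the induced metric $g$. $x$ denotes the immersion $\Sigma\to\mathbb{R}^{n+1}$ (the position vector) and $x^\perp$ its component normal to $\Sigma$. Minimal means the mean curvature (trace of the shape operator) vanishes identically. Polynomial volume growth means that there are constants $C,d\ge0$ such that the $g$-volume of $\{q\in\Sigma:|x(q)|\le r\}$ is at most $Cr^d$ for all sufficiently large $r$. *)

(* Defs.v *)
From HB Require Import structures.
From mathcomp Require Import all_boot all_order all_algebra.
From mathcomp Require Import all_classical all_reals all_analysis.

Set Implicit Arguments.
Unset Strict Implicit.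
Unset Printing Implicit Defensive.

Import Order.TTheory GRing.Theory Num.Theory.
Import numFieldNormedType.Exports.

Local Open Scope classical_set_scope.
Local Open Scope ring_scope.

Section Euclidean.
Context {R : realType}.

Definition dotp m (u v : 'rV[R]_m) : R := \sum_(i < m) u 0 i * v 0 i.

(* The norm that MathComp-Analysis puts on matrices is the sup norm. *)
Definition enorm m (v : 'rV[R]_m) : R := Num.sqrt (dotp v v).

Definition partial n m (i : 'I_n) (f : 'rV[R]_n -> 'rV[R]_m) :
  'rV[R]_n -> 'rV[R]_m := fun u => 'D_(delta_mx 0 i) f u.

(* Functions are total; only their values on the open set [V] matter. *)
Fixpoint Ck n m (k : nat) (V : set 'rV[R]_n) (f : 'rV[R]_n -> 'rV[R]_m) : Prop :=
  match k with
  | 0 => forall u, V u -> {for u, continuous f}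
  | k'.+1 => (forall u, V u -> differentiable f u) /\
             (forall i : 'I_n, Ck k' V (partial i f))
  end.

Definition smooth_on n m (V : set 'rV[R]_n) (f : 'rV[R]_n -> 'rV[R]_m) : Prop :=
  forall k, Ck k V f.

(* The integral over R^n with respect to Lebesgue measure, as an iterated
   integral; by Tonelli's theorem the two agree on the nonnegative Borel
   functions, the only ones to which it is applied. *)
Fixpoint lebesgue_int (n : nat) : ('rV[R]_n -> \bar R) -> \bar R :=
  match n with
  | 0 => fun f => f 0
  | m.+1 => fun f =>
      (\int[lebesgue_measure]_(t in [set: R])
        lebesgue_int (fun v : 'rV[R]_m => f (row_mx (t%:M : 'rV[R]_1) v)))%E
  end.

End Euclidean.

Section Manifold.
Context {R : realType} {n : nat} {S : ptopologicalType}.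

Record chart := Chart {
  chart_dom : set S ;
  chart_map :> S -> 'rV[R]_n ;
  chart_inv : 'rV[R]_n -> S ;
  chart_dom_open : open chart_dom ;
  chart_cod_open : open (chart_map @` chart_dom) ;
  chart_mapK : forall p, chart_dom p -> chart_inv (chart_map p) = p ;
  chart_map_continuous : {within chart_dom, continuous chart_map} ;
  chart_inv_continuous :
    {within chart_map @` chart_dom, continuous chart_inv} }.

Definition chart_cod (c : chart) : set 'rV[R]_n := c @` chart_dom c.

Definition transition (c d : chart) : 'rV[R]_n -> 'rV[R]_n :=
  d \o chart_inv c.

Definition smooth_atlas (A : set chart) : Prop :=
  (forall p : S, exists2 c, A c & chart_dom c p) /\
  (forall c d, A c -> A d ->
     smooth_on (c @` (chart_dom c `&` chart_dom d)) (transition c d)).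

Definition smooth_manifold (A : set chart) : Prop :=
  [/\ hausdorff_space S, @second_countable S & smooth_atlas A].

(* [B] is an oriented atlas of the smooth structure determined by [A]. *)
Definition orientable (A : set chart) : Prop :=
  exists B : set chart,
    [/\ smooth_atlas B, smooth_atlas (A `|` B) &
        forall c d p, B c -> B d -> chart_dom c p -> chart_dom d p ->
          0 < \det ('J (transition c d) (c p))].

End Manifold.
Arguments chart : clear implicits.

Section Hypersurface.
Context {R : realType} {n : nat} {S : ptopologicalType}.
Variables (A : set (chart R n S)) (x : S -> 'rV[R]_n.+1).

Definition param (c : chart R n S) : 'rV[R]_n -> 'rV[R]_n.+1 :=
  x \o chart_inv c.

(* MathComp vectors are rows: row [i] of the Jacobian is the coordinate tangent
   vector d_i (param c), so the rows span the tangent space. *)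
Definition tangent_frame (c : chart R n S) (u : 'rV[R]_n) : 'M[R]_(n, n.+1) :=
  'J (param c) u.

Definition smooth_immersion : Prop :=
  forall c, A c -> smooth_on (chart_cod c) (param c) /\
    forall u, chart_cod c u -> row_free (tangent_frame c u).

Definition proper_map : Prop :=
  forall K : set 'rV[R]_n.+1, compact K -> compact (x @^-1` K).

(* Gram matrix g_ij = <d_i, d_j> of the induced metric. *)
Definition metric (c : chart R n S) (u : 'rV[R]_n) : 'M[R]_n :=
  tangent_frame c u *m (tangent_frame c u)^T.

Definition unit_normal (c : chart R n S) (u : 'rV[R]_n) (nu : 'rV[R]_n.+1)
  : Prop :=
  enorm nu = 1 /\ forall i, dotp (row i (tangent_frame c u)) nu = 0.

Definition second_fundamental_form (c : chart R n S) (u : 'rV[R]_n)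
    (nu : 'rV[R]_n.+1) : 'M[R]_n :=
  \matrix_(i, j) dotp (partial i (partial j (param c)) u) nu.

(* The operator W on the tangent space with <W v, w> = II_nu (v, w); in the
   coordinate frame W d_i = \sum_k W_ik d_k, so that W *m g = II_nu. *)
Definition shape_operator (c : chart R n S) (u : 'rV[R]_n)
    (nu : 'rV[R]_n.+1) : 'M[R]_n :=
  second_fundamental_form c u nu *m invmx (metric c u).

Definition mean_curvature (c : chart R n S) (u : 'rV[R]_n)
    (nu : 'rV[R]_n.+1) : R :=
  \tr (shape_operator c u nu).

(* The two unit normals give opposite mean curvatures. *)
Definition minimal : Prop :=
  forall c u nu, A c -> chart_cod c u -> unit_normal c u nu ->
    mean_curvature c u nu = 0.

Definition tangent_proj (c : chart R n S) (u : 'rV[R]_n)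
    (v : 'rV[R]_n.+1) : 'rV[R]_n.+1 :=
  v *m (tangent_frame c u)^T *m invmx (metric c u) *m tangent_frame c u.

(* The position vector's normal component at [p], computed in the chart [c]. *)
Definition x_perp (c : chart R n S) (p : S) : 'rV[R]_n.+1 :=
  x p - tangent_proj c (c p) (x p).

Definition bounded_x_perp : Prop :=
  exists B : R, forall c p, A c -> chart_dom c p -> enorm (x_perp c p) <= B.

Definition volume_density (c : chart R n S) (u : 'rV[R]_n) : R :=
  Num.sqrt (\det (metric c u)).

(* The volume measure of the induced metric is the unique Borel measure given
   by sqrt (det g) du in every chart of the atlas. *)
Definition volume_measure
    (vol : {measure set (g_sigma_algebraType (@open S)) -> \bar R}) : Prop :=
  forall c (E : set (g_sigma_algebraType (@open S))),
    A c -> measurable E -> E `<=` chart_dom c ->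
    vol E = lebesgue_int
      (fun u : 'rV[R]_n => (\1_(c @` E) u * volume_density c u)%:E).

Definition polynomial_volume_growth
    (vol : {measure set (g_sigma_algebraType (@open S)) -> \bar R}) : Prop :=
  exists C d : R, [/\ 0 <= C, 0 <= d &
    \forall r \near +oo,
      (vol [set q | (enorm (x q) <= r)%R] <= (C * r `^ d)%:E)%E].

End Hypersurface.

(* Main.v *)
Require Import Defs.
From HB Require Import structures.
From mathcomp Require Import all_boot all_order all_algebra.
From mathcomp Require Import all_classical all_reals all_analysis.
From mathcomp Require Import perm measurable_realfun ring lra.

Set Implicit Arguments.
Unset Strict Implicit.
Unset Printing Implicit Defensive.

Import Order.TTheory GRing.Theory Num.Theory.
Import numFieldNormedType.Exports.

Local Open Scope classical_set_scope.
Local Open Scope ring_scope.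

(* On a minimal hypersurface the tangential position field satisfies
   div x^T = n. Integrating div (f x^T) for f = (2 s + beta - |x|^2)_+ ^ (n + 2),
   where beta bounds |x^perp|^2, gives
     int n y ^ (n + 2) - 2 (n + 2) y ^ (n + 1) |x^T|^2 = 0,
   with y = (2 s + beta - |x|^2)_+. As |x^T|^2 >= |x|^2 - beta, the integrand is
   at most n (4 s) ^ (n + 2) where |x|^2 <= s + beta, at most - (s / 2) ^ (n + 2)
   where s + beta < |x|^2 <= 3 s / 2 + beta, and nonpositive elsewhere. Hence
   v s := vol {|x|^2 <= s + beta} satisfies
   v (3 s / 2) <= (1 + n 8 ^ (n + 2)) v s, and iterating bounds v by a power.

   The divergence theorem is reduced by cutoff functions to a single chart, where
   it is Fubini together with the fundamental theorem of calculus for the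
   iterated Lebesgue integral. *)

(** The exponent n + 2 serves two purposes. Being at least 2, it makes the truncated power C^1; and
    its double exceeds n, so that outside {|x|^2 <= s + beta}, where y <= s <= |x^T|^2, the term 2
    (n + 2) |x^T|^2 absorbs n y. Properness makes f compactly supported.

    No divergence operator on the hypersurface is set up: div (f x^T) is replaced by n f + x^T f,
    where x^T f is a directional derivative that does not depend on the chart, and minimality enters
    only through a coordinate identity for x^T.

    The volume measure is specified by iterated integrals for Borel subsets of a single chart,
    whereas the argument needs linearity, Fubini and cancellation. Hence the iterated integral is
    represented by a genuine measure on R^n, and functions are transported through a chart, positive
    and negative parts separately. *)

Local Notation borel X := (g_sigma_algebraType (@open X)) (only parsing).

(** * Calculus on row vectors *)

Section Differentiability.
Context {R : realType}.

Lemma is_diff_littleo (V W : normedModType R) (f : V -> W)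
    (df : {linear V -> W}) (x : V) : continuous df ->
  (forall e, 0 < e -> \forall h \near (0 : V),
     `|f (h + x) - f x - df h| <= e * `|h|) -> is_diff x f df.
Proof.
move=> cdf fo.
have fE : f \o shift x = cst (f x) + df +o_ 0 id.
  apply/eqaddoP => e e0; have := fo _ e0; apply: filterS => h.
  by rewrite !fctE /= opprD addrA.
have dE := diff_unique cdf fE.
by apply: DiffDef => //; apply/diff_locallyP; rewrite dE.
Qed.

Lemma differentiable_littleo (V W : normedModType R) (f : V -> W) (x : V) :
  differentiable f x -> forall e, 0 < e -> \forall h \near (0 : V),
    `|f (h + x) - f x - 'd f x h| <= e * `|h|.
Proof.
move=> /diff_locallyP[_ /eqaddoP fo] e e0; have := fo _ e0; apply: filterS => h.
by rewrite !fctE /= opprD addrA.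
Qed.

Lemma near_eq_is_diff (V W : normedModType R) (f g : V -> W) (x : V) :
  (\forall w \near x, f w = g w) -> differentiable f x ->
  is_diff x g ('d f x).
Proof.
move=> fg df; apply: is_diff_littleo; first exact: diff_continuous.
move=> e e0; have := differentiable_littleo df e0.
have : \forall h \near (0 : V), f (h + x) = g (h + x).
  by move: (fg); rewrite (near_shift 0) subr0.
by apply: filterS2 => h ->; rewrite (nbhs_singleton fg).
Qed.

Lemma near_eq_differentiable (V W : normedModType R) (f g : V -> W) (x : V) :
  (\forall w \near x, f w = g w) -> differentiable f x -> differentiable g x.
Proof. by move=> fg df; have [] := near_eq_is_diff fg df. Qed.

Lemma near_eq_continuous (T U : topologicalType) (f g : T -> U) (u : T) :
  (\forall w \near u, f w = g w) ->
  {for u, continuous f} -> {for u, continuous g}.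
Proof.
move=> fg; rewrite /prop_for /continuous_at (nbhs_singleton fg) => cf.
by apply: cvg_trans cf; apply: near_eq_cvg; apply: filterS fg => w ->.
Qed.

Lemma continuous_at_sum (T : topologicalType) (I : Type) (r : seq I)
    (F : I -> T -> R) (u : T) : (forall i, {for u, continuous (F i)}) ->
  {for u, continuous (fun w => \sum_(i <- r) F i w)}.
Proof.
move=> cF; elim: r => [|i r IH].
  rewrite (_ : (fun _ => _) = cst 0); first exact: cst_continuous.
  by apply/funext => w; rewrite big_nil.
rewrite (_ : (fun _ => _) = F i \+ (fun w => \sum_(i <- r) F i w)).
  by apply: continuousD; [exact: cF|exact: IH].
by apply/funext => w; rewrite big_cons.
Qed.

End Differentiability.

Section ContinuouslyDifferentiable.
Context {R : realType}.

Definition pd n (i : 'I_n) (f : 'rV[R]_n -> R) : 'rV[R]_n -> R :=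
  fun u => 'D_(delta_mx 0 i) f u.

(** Differentiability is asked near [u], continuity of the partial derivatives only at [u]. This
    pointwise form depends only on the germ at [u], which suits functions whose values matter only
    on an open chart codomain. *)
Definition C1at n (f : 'rV[R]_n -> R) (u : 'rV[R]_n) : Prop :=
  (\forall w \near u, differentiable f w) /\
  (forall i, {for u, continuous (pd i f)}).

Section Fixed.
Context {n : nat}.
Implicit Types (f g : 'rV[R]_n -> R) (u : 'rV[R]_n).

Lemma C1at_diff f u : C1at f u -> differentiable f u.
Proof. by case=> /nbhs_singleton. Qed.

Lemma C1at_derivable f u v : C1at f u -> derivable f u v.
Proof. by move/C1at_diff/diff_derivable. Qed.

Lemma C1at_continuous f u : C1at f u -> {for u, continuous f}.
Proof. by move/C1at_diff/differentiable_continuous. Qed.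

Lemma near_eq_pd i f g u :
  (\forall w \near u, f w = g w) -> pd i f u = pd i g u.
Proof. by move=> fg; rewrite /pd; apply: near_eq_derive. Qed.

Lemma near_eq_C1at f g u :
  (\forall w \near u, f w = g w) -> C1at f u -> C1at g u.
Proof.
move=> /[dup] /near_join fg2 fg [df cf]; split.
  near=> w; apply: (@near_eq_differentiable _ _ _ f); by near: w.
move=> i; apply: near_eq_continuous (cf i).
by near=> w; apply: near_eq_pd; near: w.
Unshelve. all: by end_near. Qed.

Lemma C1atP f (df : 'I_n -> 'rV[R]_n -> R) u :
  (\forall w \near u, differentiable f w) ->
  (\forall w \near u, forall i, pd i f w = df i w) ->
  (forall i, {for u, continuous (df i)}) -> C1at f u.
Proof.
move=> ? e c; split=> // i; apply: near_eq_continuous (c i).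
by near=> w; apply/esym; near: w; apply: filterS e => w.
Unshelve. all: by end_near. Qed.

Lemma pd_cst i (k : R) u : pd i (cst k) u = 0.
Proof. by rewrite /pd derive_cst. Qed.

Lemma C1at_cst (k : R) u : C1at (fun=> k) u.
Proof.
apply: (@C1atP _ (fun _ _ => 0)).
- by near=> w; exact: differentiable_cst.
- by near=> w => i; exact: pd_cst.
- by move=> i; exact: cst_continuous.
Unshelve. all: by end_near. Qed.

Lemma pdD i f g u : differentiable f u -> differentiable g u ->
  pd i (fun w => f w + g w) u = pd i f u + pd i g u.
Proof. by move=> df dg; rewrite /pd -deriveD//; exact: diff_derivable. Qed.

Lemma pdM i f g u : differentiable f u -> differentiable g u ->
  pd i (fun w => f w * g w) u = pd i f u * g u + f u * pd i g u.
Proof.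
move=> df dg; rewrite /pd (@deriveM _ _ f g); do ?exact: diff_derivable.
by rewrite addrC mulrC.
Qed.

Lemma C1atD f g u : C1at f u -> C1at g u -> C1at (fun w => f w + g w) u.
Proof.
move=> [df cf] [dg cg]; apply: (@C1atP _ (fun i w => pd i f w + pd i g w)).
- by near=> w; apply: differentiableD; near: w.
- by near=> w => i; apply: pdD; near: w.
- by move=> i; apply: continuousD; [exact: cf|exact: cg].
Unshelve. all: by end_near. Qed.

Lemma C1atM f g u : C1at f u -> C1at g u -> C1at (fun w => f w * g w) u.
Proof.
move=> /[dup] /C1at_continuous f0 [df cf] /[dup] /C1at_continuous g0 [dg cg].
apply: (@C1atP _ (fun i w => pd i f w * g w + f w * pd i g w)).
- by near=> w; apply: differentiableM; near: w.
- by near=> w => i; apply: pdM; near: w.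
- move=> i; apply: continuousD.
    by apply: (@continuousM _ _ (pd i f) g) => //; exact: cf.
  by apply: (@continuousM _ _ f (pd i g)) => //; exact: cg.
Unshelve. all: by end_near. Qed.

Lemma C1atN f u : C1at f u -> C1at (fun w => - f w) u.
Proof.
move=> cf; apply: near_eq_C1at (C1atM (C1at_cst (-1) u) cf).
by near=> w; rewrite mulN1r.
Unshelve. all: by end_near. Qed.

Lemma C1at_sum (I : Type) (r : seq I) (P : pred I) (F : I -> 'rV[R]_n -> R) u :
  (forall i, P i -> C1at (F i) u) -> C1at (fun w => \sum_(i <- r | P i) F i w) u.
Proof.
move=> cF; elim: r => [|i r IH].
  apply: near_eq_C1at (C1at_cst 0 u).
  by near=> w; rewrite big_nil.
case: (boolP (P i)) => Pi.
  apply: near_eq_C1at (C1atD (cF _ Pi) IH).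
  by near=> w; rewrite big_cons Pi.
by apply: near_eq_C1at IH; near=> w; rewrite big_cons (negbTE Pi).
Unshelve. all: by end_near. Qed.

Lemma C1at_prod (I : Type) (r : seq I) (P : pred I) (F : I -> 'rV[R]_n -> R) u :
  (forall i, P i -> C1at (F i) u) ->
  C1at (fun w => \prod_(i <- r | P i) F i w) u.
Proof.
move=> cF; elim: r => [|i r IH].
  apply: near_eq_C1at (C1at_cst 1 u).
  by near=> w; rewrite big_nil.
case: (boolP (P i)) => Pi.
  apply: near_eq_C1at (C1atM (cF _ Pi) IH).
  by near=> w; rewrite big_cons Pi.
by apply: near_eq_C1at IH; near=> w; rewrite big_cons (negbTE Pi).
Unshelve. all: by end_near. Qed.

Lemma pd_sum i (I : Type) (r : seq I) (F : I -> 'rV[R]_n -> R) u :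
  (forall k, C1at (F k) u) ->
  pd i (fun w => \sum_(k <- r) F k w) u = \sum_(k <- r) pd i (F k) u.
Proof.
move=> cF; elim: r => [|k r IH].
  rewrite big_nil -[RHS](pd_cst i 0 u); congr pd.
  by apply/funext => w; rewrite big_nil.
rewrite big_cons -IH -pdD.
- by congr pd; apply/funext => w; rewrite big_cons.
- exact: C1at_diff.
- by apply: C1at_diff; apply: C1at_sum.
Qed.

Lemma pd_comp1 i (g g' : R -> R) f u : differentiable f u ->
  is_derive (f u) 1 g (g' (f u)) ->
  pd i (g \o f) u = g' (f u) * pd i f u.
Proof.
move=> df [dg eg]; have dg' : differentiable g (f u) by exact/derivable1_diffP.
have dgf : differentiable (g \o f) u by exact: differentiable_comp.
rewrite /pd !deriveE// diff_comp//= (deriv1E dg) derive1E eg.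
by rewrite mulrC.
Qed.

Lemma C1at_comp1 (g g' : R -> R) f u : C1at f u ->
  (\forall t \near f u, is_derive (t : R) 1 g (g' t)) ->
  {for f u, continuous g'} -> C1at (fun w => g (f w)) u.
Proof.
move=> /[dup] /C1at_continuous f0 [df cf] dg cg'.
have dgf : \forall w \near u, is_derive (f w) 1 g (g' (f w)).
  by move: dg => /f0.
apply: (@C1atP _ (fun i w => g' (f w) * pd i f w)).
- near=> w; apply: differentiable_comp; first by near: w.
  apply/derivable1_diffP.
  have : is_derive (f w) 1 g (g' (f w)) by near: w.
  by case.
- by near=> w => i; apply: pd_comp1; near: w.
- move=> i; apply: (@continuousM _ _ (g' \o f) (pd i f)); last exact: cf.
  exact: continuous_comp.
Unshelve. all: by end_near. Qed.

Lemma C1atV f u : f u != 0 -> C1at f u -> C1at (fun w => (f w)^-1) u.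
Proof.
move=> fu0 cf; apply: (@C1at_comp1 GRing.inv (fun t => - t ^- 2)) => //.
- have : \forall t \near f u, t != 0.
    by apply: open_nbhs_nbhs; split=> //; exact: open_neq.
  apply: filterS => t t0; apply: is_derive_eq.
    by apply: DeriveDef => //; exact: derivableV.
  by rewrite deriveV// derive_id scaler1.
- apply: continuousN; apply: continuousV; first by rewrite expf_neq0.
  exact: exprn_continuous.
Qed.

Lemma C1at_sqrt f u : 0 < f u -> C1at f u -> C1at (fun w => Num.sqrt (f w)) u.
Proof.
move=> fu0 cf.
apply: (@C1at_comp1 Num.sqrt (fun t => (2 * Num.sqrt t)^-1)) => //.
- have : \forall t \near f u, 0 < t.
    by apply: open_nbhs_nbhs; split=> //; exact: open_gt.
  by apply: filterS => t t0; exact: is_derive1_sqrt.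
- apply: continuousV; first by rewrite mulf_neq0// gt_eqF// sqrtr_gt0.
  by apply: continuousM; [exact: cst_continuous|exact: sqrt_continuous].
Qed.

Lemma pd_sqrt i f u : 0 < f u -> differentiable f u ->
  pd i (fun w => Num.sqrt (f w)) u = (2 * Num.sqrt (f u))^-1 * pd i f u.
Proof.
move=> fu0 df.
apply: (@pd_comp1 i Num.sqrt (fun t => (2 * Num.sqrt t)^-1) f u df).
exact: is_derive1_sqrt.
Qed.

Lemma C1at_coord (j : 'I_n) u : C1at (fun w : 'rV[R]_n => w 0 j) u.
Proof.
apply: (@C1atP _ (fun i _ => (delta_mx 0 i : 'rV[R]_n) 0 j)).
- by near=> w; exact: differentiable_coord.
- near=> w => i; rewrite /pd.
  rewrite -[in RHS](derive_id w (delta_mx 0 i)) derive_mx ?mxE//.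
- by move=> i; exact: cst_continuous.
Unshelve. all: by end_near. Qed.

End Fixed.

Lemma diff_pd n (f : 'rV[R]_n -> R) u v : differentiable f u ->
  'd f u v = \sum_j v 0 j * pd j f u.
Proof.
move=> df; rewrite [v in LHS]row_sum_delta linear_sum; apply: eq_bigr => j _.
by rewrite linearZ /pd deriveE.
Qed.

Lemma pd_comp n m i (f : 'rV[R]_n -> R) (T : 'rV[R]_m -> 'rV[R]_n) u :
  differentiable T u -> differentiable f (T u) ->
  pd i (fun w => f (T w)) u = \sum_j (partial i T u) 0 j * pd j f (T u).
Proof.
move=> dT df; have dfT : differentiable (f \o T) u by exact: differentiable_comp.
by rewrite -diff_pd// /partial /pd !deriveE// diff_comp.
Qed.

Lemma C1at_comp n m (f : 'rV[R]_n -> R) (T : 'rV[R]_m -> 'rV[R]_n) u :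
  C1at f (T u) -> (\forall w \near u, differentiable T w) ->
  (forall i, {for u, continuous (partial i T)}) -> C1at (fun w => f (T w)) u.
Proof.
move=> [df cf] dT cT.
have T0 : {for u, continuous T}.
  by apply: differentiable_continuous; exact: nbhs_singleton dT.
have dfT : \forall w \near u, differentiable f (T w) by move: df => /T0.
apply: (@C1atP _ _ (fun i w => \sum_j (partial i T w) 0 j * pd j f (T w))).
- by near=> w; apply: differentiable_comp; near: w.
- by near=> w => i; apply: pd_comp; near: w.
- move=> i; apply: continuous_at_sum => j.
  apply: (@continuousM _ _ (fun w => partial i T w 0 j) (fun w => pd j f (T w))).
    apply: (@continuous_comp _ _ _ (partial i T) (fun v : 'rV[R]_n => v 0 j)).
      exact: cT.
    exact: coord_continuous.
  by apply: continuous_comp => //; exact: cf.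
Unshelve. all: by end_near. Qed.

End ContinuouslyDifferentiable.

(** * Symmetry of mixed partial derivatives *)

Section Schwarz.
Context {R : realType}.

(** The two difference quotients coincide as functions of the increment, so a directional derivative
    of [g] suffices. *)
Lemma is_derive_line (V : normedModType R) (g : V -> R) (a v : V) (s : R) :
  derivable g (s *: v + a) v ->
  is_derive (s : R) 1 (fun t : R => g (t *: v + a)) ('D_v g (s *: v + a)).
Proof.
have E : (fun h : R => h^-1 *: (g ((h *: (1 : R) + s) *: v + a) - g (s *: v + a))) =
    (fun h : R => h^-1 *: (g (h *: v + (s *: v + a)) - g (s *: v + a))).
  by apply/funext => h; rewrite [h *: 1]mulr1 scalerDl addrA.
move=> dg; apply: DeriveDef; first by rewrite /derivable /= E.
by rewrite /derive /= E.
Qed.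

Section Fixed.
Context {n : nat} (f : 'rV[R]_n -> R) (u : 'rV[R]_n).

(** Symmetric in [v] and [w], and up to the factor h^2 an approximation of either mixed
    derivative. *)
Definition second_difference (v w : 'rV[R]_n) :=
  f (v + w + u) - f (v + u) - f (w + u) + f u.

Lemma second_differenceC v w : second_difference v w = second_difference w v.
Proof. by rewrite /second_difference [w + v]addrC -!addrA [in RHS](addrCA (- _)). Qed.

(** The mean value theorem is applied twice: along [i] to the increment [phi] of [f] across the side
    [j], then along [j] to [pd i f]. *)
Lemma mean_value_second_difference (i j : 'I_n) (e h : R) :
  (forall w, ball u e w -> differentiable f w /\ differentiable (pd i f) w) ->
  0 < h -> h * (`|delta_mx 0 i : 'rV[R]_n| + `|delta_mx 0 j : 'rV[R]_n|) < e ->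
  exists2 w, ball u e w &
    second_difference (h *: delta_mx 0 i) (h *: delta_mx 0 j) =
      h * h * pd j (pd i f) w.
Proof.
set ei : 'rV[R]_n := delta_mx 0 i; set ej : 'rV[R]_n := delta_mx 0 j.
move=> df h0 he.
have inb s t : s \in `[0, h] -> t \in `[0, h] -> ball u e (s *: ei + (t *: ej + u)).
  rewrite !in_itv/= => /andP[s0 sh] /andP[t0 th].
  rewrite -ball_normE /ball_ /= distrC addrA addrK.
  apply: le_lt_trans he; apply: le_trans (ler_normD _ _) _.
  rewrite !normrZ (ger0_norm s0) (ger0_norm t0) mulrDr. by apply: lerD; apply: ler_wpM2r.
have h_in : h \in `[0, h] by rewrite in_itv/= lexx ltW.
have z_in : 0 \in `[0, h] by rewrite in_itv/= lexx ltW.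
have sub x : x \in `]0, h[ -> x \in `[0, h].
  by rewrite !in_itv/= => /andP[/ltW-> /ltW->].
pose phi (s : R) : R := f (s *: ei + (h *: ej + u)) - f (s *: ei + (0 *: ej + u)).
have dphi (s : R) : s \in `[0, h] -> is_derive s 1 phi
    (pd i f (s *: ei + (h *: ej + u)) - pd i f (s *: ei + (0 *: ej + u))).
  move=> sh; apply: is_deriveB.
    by apply: is_derive_line; apply: diff_derivable; have [] := df _ (inb _ _ sh h_in).
  by apply: is_derive_line; apply: diff_derivable; have [] := df _ (inb _ _ sh z_in).
have [] := @MVT_segment _ phi _ 0 h (ltW h0) (fun x xh => dphi x (sub _ xh)).
  by apply: derivable_within_continuous => x xh; have [] := dphi _ xh.
move=> s sh; rewrite subr0 => phiE.
pose psi (t : R) : R := pd i f (t *: ej + (s *: ei + u)).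
have swap t : t *: ej + (s *: ei + u) = s *: ei + (t *: ej + u) by rewrite addrCA.
have dpsi (t : R) : t \in `[0, h] -> is_derive t 1 psi
    (pd j (pd i f) (t *: ej + (s *: ei + u))).
  move=> th; apply: is_derive_line; apply: diff_derivable.
  by rewrite swap; have [] := df _ (inb _ _ sh th).
have [] := @MVT_segment _ psi _ 0 h (ltW h0) (fun x xh => dpsi x (sub _ xh)).
  by apply: derivable_within_continuous => x xh; have [] := dpsi _ xh.
move=> t th; rewrite subr0 /psi !swap => psiE.
exists (s *: ei + (t *: ej + u)); first exact: inb.
rewrite -mulrA mulrC [h * _]mulrC -psiE -phiE /second_difference /phi.
by rewrite !scale0r !add0r !addrA opprB addrA addrAC.
Qed.

End Fixed.

Lemma distr_le_half (a b c e : R) :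
  `|a - c| < e / 2 -> `|b - c| < e / 2 -> `|b - a| <= e.
Proof.
rewrite !ltr_norml ler_norml => /andP[? ?] /andP[? ?].
by apply/andP; split; lra.
Qed.

(** Both orders of differentiation evaluate the same second difference, so the two mixed derivatives
    take a common value at points [w] and [w'] near [u]; their continuity at [u] does the rest. *)
Lemma pd_comm n (f : 'rV[R]_n -> R) (u : 'rV[R]_n) (i j : 'I_n) :
  (\forall w \near u, differentiable f w) -> C1at (pd i f) u ->
  C1at (pd j f) u -> pd i (pd j f) u = pd j (pd i f) u.
Proof.
move=> df [di /(_ j) ci] [dj /(_ i) cj].
apply/eqP; rewrite -subr_eq0 -normr_le0; apply/ler_addgt0Pl => eps eps0.
rewrite addr0.
have eps2 : 0 < eps / 2 by rewrite divr_gt0.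
move/cvgrPdist_lt : ci => /(_ _ eps2) ci.
move/cvgrPdist_lt : cj => /(_ _ eps2) cj.
have : \forall w \near u,
   [/\ differentiable f w, differentiable (pd i f) w, differentiable (pd j f) w,
   `|pd j (pd i f) u - pd j (pd i f) w| < eps / 2 &
   `|pd i (pd j f) u - pd i (pd j f) w| < eps / 2].
  apply: filterS (filterI (filterI df di) (filterI dj (filterI ci cj))).
  move=> w [[d1 d2] [d3 [d4 d5]]].
  by split; [exact: d1|exact: d2|exact: d3|exact: d4|exact: d5].
move=> /nbhs_ballP[e /= e0 eP].
pose M := `|delta_mx 0 i : 'rV[R]_n| + `|delta_mx 0 j : 'rV[R]_n|.
have M1 : 0 < M + 1 by rewrite ltr_wpDl// addr_ge0.
(* With this side length the parallelogram at [u] stays in the ball; [M + 1] keeps the inequality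
   strict. *)
pose h := e / (M + 1).
have h0 : 0 < h by rewrite divr_gt0.
have hM : h * M < e.
  by rewrite /h mulrAC ltr_pdivrMr// ltr_pM2l// ltrDl.
have [w wu E1] : exists2 w, ball u e w &
    second_difference f u (h *: delta_mx 0 i) (h *: delta_mx 0 j) =
      h * h * pd j (pd i f) w.
  by apply: mean_value_second_difference hM => // z /eP[].
have [w' wu' E2] : exists2 w, ball u e w &
    second_difference f u (h *: delta_mx 0 j) (h *: delta_mx 0 i) =
      h * h * pd i (pd j f) w.
  by apply: mean_value_second_difference => [z /eP[]//|//|]; rewrite addrC.
have E : pd j (pd i f) w = pd i (pd j f) w'.
  have hh : h * h != 0 by rewrite mulf_neq0// gt_eqF.
  apply: (mulfI hh); move: E1 E2.
  set a := pd j _ _; set b := pd i _ _; rewrite [in X in _ -> X]second_differenceC.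
  by move=> e1 e2; exact: etrans (esym e1) e2.
have [_ _ _ c1 _] := eP _ wu; have [_ _ _ _ c2] := eP _ wu'.
move: c1 c2; rewrite -E.
exact: distr_le_half.
Qed.

End Schwarz.

(** * Lebesgue measure on row vectors *)

Section BorelVectors.
Context {R : realType}.

Lemma borel_open (X : ptopologicalType) (U : set (borel X)) :
  @open X U -> measurable U.
Proof. exact: sub_sigma_algebra. Qed.

Lemma borel_closed (X : ptopologicalType) (U : set (borel X)) :
  @closed X U -> measurable U.
Proof.
by move=> /closed_openC/borel_open/measurableC; rewrite setCK.
Qed.

Lemma continuous_at_measurable (X : ptopologicalType) (D : set X) (f : X -> R) :
  open D -> (forall p, D p -> {for p, continuous f}) ->
  measurable_fun (D : set (borel X)) f.
Proof.
move=> oD cf; apply: (measurability _ (measurable_realfun.RGenOpens.measurableE R)).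
move=> _ [_ [a [b ->] <-]]; apply: borel_open.
rewrite openE => p [Dp fp]; rewrite /interior; near=> q; split; near: q.
  exact: open_nbhs_nbhs.
by apply: (cf _ Dp); apply: open_nbhs_nbhs; split => //; exact: interval_open.
Unshelve. all: by end_near. Qed.

Definition rational_ball n (k : 'rV[rat]_n * nat) : set 'rV[R]_n :=
  ball (map_mx ratr k.1 : 'rV[R]_n) k.2.+1%:R^-1.

Lemma open_bigcup_rational_ball n (U : set 'rV[R]_n) : open U ->
  U = \bigcup_k [set w | rational_ball k `<=` U /\ rational_ball k w].
Proof.
move=> oU; apply/seteqP; split => [v Uv|v [k _ [kU kv]]]; last exact: kU.
have /nbhs_ballP[e /= e0 eU] : nbhs v U by exact: open_nbhs_nbhs.
have e2 : 0 < e / 2 by rewrite divr_gt0.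
have [m _ /(_ m (leqnn m)) /= me] := near_infty_natSinv_lt (PosNum e2).
have m0 : 0 < m.+1%:R^-1 :> R by rewrite invr_gt0.
have /choice[q qP] i : exists q : rat, `|v 0 i - ratr q| < m.+1%:R^-1.
  have /rat_in_itvoo[q] : v 0 i - m.+1%:R^-1 < v 0 i + m.+1%:R^-1.
    by rewrite ltrBlDr -addrA ltrDl addr_gt0.
  rewrite in_itv/= => /andP[q1 q2]; exists q.
  move: q1 q2; set r := ratr q; set x := v 0 i; set d := _^-1 => q1 q2.
  by rewrite ltr_norml; apply/andP; split; lra.
exists (\row_i q i, m) => //.
have vq : rational_ball (\row_i q i, m) v.
  rewrite /rational_ball/=; split=> // i j; rewrite !mxE ord1 /ball/=.
  by rewrite distrC.
split=> // w wq; apply: eU; rewrite (splitr e).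
apply: (@le_ball _ _ v (m.+1%:R^-1 + m.+1%:R^-1)); first by rewrite lerD// ltW.
exact: ball_triangle (ball_sym vq) wq.
Qed.

(** Open sets are countable unions of rational balls, and a ball of the sup norm is a box, so its
    preimage is a finite intersection of conditions on single coordinates. *)
Lemma measurable_fun_rV d (T : measurableType d) n (f : T -> 'rV[R]_n) :
  (forall i, measurable_fun setT (fun t => f t 0 i)) ->
  measurable_fun setT (f : T -> borel 'rV[R]_n).
Proof.
move=> mf; apply: (@measurability _ _ T (borel 'rV[R]_n) setT f (@open 'rV[R]_n)) => //.
move=> _ [U oU <-]; rewrite setTI (open_bigcup_rational_ball oU) preimage_bigcup.
apply: countable_bigcupT_measurable => [|k]; first exact: countableP.
have [kU|kU] := pselect (rational_ball k `<=` U); last first.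
  by rewrite (_ : _ @^-1` _ = set0)// -subset0 => t [].
rewrite (_ : _ @^-1` _ = \bigcap_(i : 'I_n)
    (fun t => f t 0 i) @^-1` ball (ratr (k.1 0 i) : R) k.2.+1%:R^-1); last first.
  apply/seteqP; split => [t [_ [_ kt]] i _|t kt] /=.
    by have := kt 0 i; rewrite mxE.
  split=> //; split; first by rewrite invr_gt0.
  by move=> i j; rewrite mxE ord1; exact: kt.
apply: fin_bigcap_measurable => // i _.
rewrite -[X in measurable X]setTI; apply: mf => //.
apply: open_measurable; exact: ball_open.
Qed.

Lemma measurable_coord n (i : 'I_n) :
  measurable_fun setT (fun v : borel 'rV[R]_n => v 0 i : R).
Proof.
apply: (@continuous_at_measurable _ setT (fun v : 'rV[R]_n => v 0 i)).
  exact: openT.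
by move=> v _; exact: coord_continuous.
Qed.

(** Splits off the first coordinate exactly as the recursion of [lebesgue_int] does. *)
Definition rV_cons n (p : R * 'rV[R]_n) : 'rV[R]_n.+1 :=
  row_mx (p.1%:M : 'rV[R]_1) p.2.

Lemma rV_cons0 n p : @rV_cons n p 0 0 = p.1.
Proof.
rewrite /rV_cons; have -> : (0 : 'I_n.+1) = lshift n (0 : 'I_1) by exact/val_inj.
by rewrite (@row_mxEl _ 1 1 n) mxE.
Qed.

Lemma rV_consS n p i : @rV_cons n p 0 (lift ord0 i) = p.2 0 i.
Proof.
rewrite /rV_cons; have -> : lift ord0 i = rshift 1 i by exact/val_inj.
by rewrite (@row_mxEr _ 1 1 n).
Qed.

Lemma measurable_rV_cons n :
  measurable_fun setT (@rV_cons n : measurableTypeR R * borel 'rV[R]_n -> borel 'rV[R]_n.+1).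
Proof.
apply: measurable_fun_rV => i; case: (unliftP ord0 i) => [j ->|->].
- under eq_fun do rewrite rV_consS.
  exact: (measurableT_comp (measurable_coord j) measurable_snd).
- under eq_fun do rewrite rV_cons0.
  exact: measurable_fst.
Qed.

End BorelVectors.

(* A wrapper whose argument lets a proof of sigma-finiteness become part of the
   structure of a measure. *)
Section SigmaFiniteCopy.
Context d (T : measurableType d) (R : realType).
Variables (mu : {measure set T -> \bar R}) (mu_sigma : sigma_finite setT mu).

Definition sigma_finite_copy of sigma_finite setT mu : set T -> \bar R := mu.
Local Notation nu := (sigma_finite_copy mu_sigma).

HB.instance Definition _ := isMeasure.Build _ _ _ nu
  (measure0 mu) (measure_ge0 mu) (@measure_semi_sigma_additive _ _ _ mu).

HB.instance Definition _ := @Measure_isSigmaFinite.Build _ _ _ nu mu_sigma.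

End SigmaFiniteCopy.

Section LebesgueVectors.
Context {R : realType}.

Notation lambda := (@lebesgue_measure R).

Lemma bounded_support_integrable d (T : measurableType d)
    (mu : {measure set T -> \bar R}) (A : set T) (K : R) (f : T -> R) :
  measurable A -> (mu A < +oo)%E -> measurable_fun setT f ->
  (forall t, A t -> `|f t| <= K) -> (forall t, ~ A t -> f t = 0) ->
  mu.-integrable setT (EFin \o f).
Proof.
move=> mA Aoo mf fK f0.
have iA : mu.-integrable A (EFin \o f).
  apply: measurable_bounded_integrable => //; first exact: measurable_funTS.
  exists K; split; first exact: num_real.
  by move=> x Kx t At; apply: le_trans (ltW Kx); exact: fK.
move/(integrable_mkcond _ mA) : iA; congr (_.-integrable _ _).
apply/funext => t; rewrite patchE; case: ifPn => // /negP At /=.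
by rewrite f0// => At'; apply: At; rewrite inE.
Qed.

Lemma support_derive0 (g g' : R -> R) (M : R) :
  (forall t : R, is_derive t 1 g (g' t)) -> (forall t, M < `|t| -> g t = 0) ->
  forall t, M < `|t| -> g' t = 0.
Proof.
move=> dg g0 t Mt; have [_ <-] := dg t.
rewrite (@near_eq_derive _ _ _ g (cst 0) t) ?derive_cst//.
have : \forall s \near t, M < `|s|.
  exact: (@cvgr_norm_gt _ _ _ (nbhs t) _ id t cvg_id).
by apply: filterS => s /g0.
Qed.

Lemma integral_derive_compact_support (g g' : R -> R) (M : R) :
  (forall t : R, is_derive t 1 g (g' t)) -> continuous g' ->
  (forall t, M < `|t| -> g t = 0) ->
  (\int[lambda]_t (g' t)%:E = 0)%E.
Proof.
move=> dg cg' g0; have g'0 := support_derive0 dg g0.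
(* Strictly beyond [M], whatever its sign, so that [g] vanishes at both ends of [-b, b]. *)
pose b : R := `|M| + 1.
have Mb : M < `|b|.
  by rewrite ger0_norm ?addr_ge0// /b ltr_pwDr// ler_norm.
have b0 : 0 < b by rewrite /b ltr_wpDl.
have cg : continuous g.
  move=> t; apply: differentiable_continuous; apply/derivable1_diffP.
  by have [] := dg t.
transitivity (\int[lambda]_(t in `[(- b)%R, b]) (g' t)%:E)%E.
  rewrite [RHS]integral_mkcond; apply: eq_integral => t _.
  rewrite patchE; case: ifPn => // /negP tb; rewrite g'0//.
  rewrite ltNge; apply/negP => tM; apply: tb; rewrite inE/= in_itv/= -ler_norml.
  by rewrite (le_trans tM)// (le_trans (ler_norm M))// /b lerDl.
rewrite (@continuous_FTC2 _ g' g)//.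
- by rewrite !g0 ?normrN// subee.
- by rewrite gtrN.
- by apply: continuous_subspaceT => t; exact: cg'.
- split.
  + by move=> t _; have [] := dg t.
  + exact/cvg_at_right_filter/cg.
  + exact/cvg_at_left_filter/cg.
- by move=> t _; rewrite derive1E; have [_ ->] := dg t.
Qed.

Lemma rV_cons_line0 n t (v : 'rV[R]_n) :
  rV_cons (t, v) = t *: delta_mx 0 ord0 + rV_cons (0, v).
Proof.
apply/rowP => i; case: (unliftP ord0 i) => [j ->|->].
  by rewrite [RHS]mxE !rV_consS !mxE/= mulr0 add0r.
by rewrite [RHS]mxE !rV_cons0 !mxE /= mulr1 addr0.
Qed.

Lemma rV_cons_lineS n t h j (v : 'rV[R]_n) :
  rV_cons (t, h *: delta_mx 0 j + v) =
  h *: delta_mx 0 (lift ord0 j) + rV_cons (t, v).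
Proof.
apply/rowP => i; case: (unliftP ord0 i) => [k ->|->].
  by rewrite [RHS]mxE !rV_consS !mxE (inj_eq lift_inj).
by rewrite [RHS]mxE !rV_cons0 !mxE /= mulr0 add0r.
Qed.

Lemma pd_rV_cons n t (F : 'rV[R]_n.+1 -> R) j (v : 'rV[R]_n) :
  pd j (fun w => F (rV_cons (t, w))) v = pd (lift ord0 j) F (rV_cons (t, v)).
Proof.
have E : (fun h : R => h^-1 *: (F (rV_cons (t, h *: delta_mx 0 j + v)) -
    F (rV_cons (t, v)))) = (fun h => h^-1 *:
    (F (h *: delta_mx 0 (lift ord0 j) + rV_cons (t, v)) - F (rV_cons (t, v)))).
  by apply/funext => h; rewrite rV_cons_lineS.
by rewrite /pd /derive /= E.
Qed.

Lemma rV_cons_norm n t (v : 'rV[R]_n) M :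
  (`|rV_cons (t, v)| <= M) = (`|t| <= M) && (`|v| <= M).
Proof.
(* The clause [0 <= M] is all that remains of the bound when [m] is 0. *)
have normE m (w : 'rV[R]_m) :
    reflect (0 <= M /\ forall i, `|w 0 i| <= M) (`|w| <= M).
  rewrite /Num.Def.normr/= mx_normrE; apply: (iffP (bigmax_leP _ _ _ _)).
    by move=> [M0 wM]; split=> // i; exact: (wM (0, i)).
  by move=> [M0 wM]; split=> // -[k i] _; rewrite ord1; exact: wM.
apply/normE/andP => [[M0 cM]|[tM /normE[M0 vM]]].
  split; first by have := cM 0; rewrite rV_cons0.
  by apply/normE; split=> // i; have := cM (lift ord0 i); rewrite rV_consS.
split=> // i; case: (unliftP ord0 i) => [k ->|->].
  by rewrite rV_consS.
by rewrite rV_cons0.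
Qed.

Lemma differentiable_rV_cons n t (v : 'rV[R]_n) :
  differentiable (fun w => rV_cons (t, w)) v.
Proof.
have -> : (fun w : 'rV[R]_n => rV_cons (t, w)) =
  cst (t *: delta_mx 0 ord0) + \sum_(j < n) (fun w : 'rV[R]_n => w 0 j *: delta_mx 0 (lift ord0 j)).
  apply/funext => w; apply/rowP => i; rewrite !fctE fct_sumE [RHS]mxE summxE.
  case: (unliftP ord0 i) => [k ->|->].
    rewrite rV_consS !mxE /= mulr0 add0r (bigD1 k)//= !mxE !eqxx mulr1.
    rewrite big1 ?addr0// => j jk; rewrite !mxE (inj_eq lift_inj).
    by rewrite eq_sym (negbTE jk) mulr0.
  rewrite rV_cons0 !mxE /= mulr1 big1 ?addr0// => j _.
  by rewrite !mxE mulr0.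
apply: differentiableD => //; apply: differentiable_sum => j.
by apply: differentiableZl; exact: differentiable_coord.
Qed.

Lemma C1at_rV_cons n t (F : 'rV[R]_n.+1 -> R) (v : 'rV[R]_n) :
  C1at F (rV_cons (t, v)) -> C1at (fun w => F (rV_cons (t, w))) v.
Proof.
move=> [dF cF].
have ct : {for v, continuous (fun w => rV_cons (t, w))}.
  exact/differentiable_continuous/differentiable_rV_cons.
apply: (@C1atP _ _ _ (fun j w => pd (lift ord0 j) F (rV_cons (t, w)))).
- have : \forall w \near v, differentiable F (rV_cons (t, w)) by move: dF => /ct.
  apply: filterS => w dw; apply: differentiable_comp => //.
  exact: differentiable_rV_cons.
- by near=> w => j; exact: pd_rV_cons.
- by move=> j; apply: continuous_comp => //; exact: cF.
Unshelve. all: by end_near. Qed.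

End LebesgueVectors.

(** * A measure representing the iterated integral *)

Section LebesgueExists.
Context {R : realType}.

Notation lambda := (@lebesgue_measure R).

Lemma continuous_compact_support_bounded n (f : 'rV[R]_n -> R) (M : R) :
  continuous f -> (forall u, M < `|u| -> f u = 0) ->
  exists K, forall u, `|f u| <= K.
Proof.
move=> cf f0.
have cM : compact [set u : 'rV[R]_n | `|u| <= M].
  apply: bounded_closed_compact.
    exists M; split; first exact: num_real.
    by move=> K MK u /= uM; apply: le_trans (ltW MK).
  apply: (@preimage_closed _ _ (fun u : 'rV[R]_n => `|u|) [set t | t <= M]).
    by move=> u _; exact: norm_continuous.
  exact: closed_le.
have /compact_bounded[K [_ KP]] : compact (f @` [set u : 'rV[R]_n | `|u| <= M]).
  by apply: continuous_compact => //; apply: continuous_subspaceT => u; exact: cf.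
exists (`|K| + 1) => u; have [uM|Mu] := leP `|u| M.
  by apply: (KP (`|K| + 1)); [rewrite ltr_pwDr// ler_norm|exists u].
by rewrite f0// normr0 addr_ge0.
Qed.

Lemma support_pd0 n i (F : 'rV[R]_n -> R) (M : R) :
  (forall u, M < `|u| -> F u = 0) -> forall u, M < `|u| -> pd i F u = 0.
Proof.
move=> F0 u Mu; rewrite (@near_eq_pd _ _ _ _ (cst 0)) ?pd_cst//.
have : \forall s \near u, M < `|s|.
  exact: (@cvgr_norm_gt _ _ _ (nbhs u) _ id u cvg_id).
by apply: filterS => s /F0.
Qed.

Lemma measurable_norm_le n (M : R) : measurable ([set v | `|v| <= M] : set (borel 'rV[R]_n)).
Proof.
apply: borel_closed.
apply: (@preimage_closed _ _ (fun u : 'rV[R]_n => `|u|) [set t | t <= M]).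
  by move=> u _; exact: norm_continuous.
exact: closed_le.
Qed.

(** Kept transparent, so that integrals against it unfold to integrals against
    [pushforward mu phi]. *)
Definition measure_pushforward d1 d2 (X : measurableType d1)
    (Y : measurableType d2) (phi : X -> Y) (mphi : measurable_fun setT phi)
    (mu : {measure set X -> \bar R}) : {measure set Y -> \bar R}.
Proof. by refine (pushforward mu phi : {measure set Y -> \bar R}). Defined.

(** The induction on the dimension carries all three properties together. The first links [mu] to
    the description of the volume; the second gives sigma-finiteness, hence Fubini in the next
    dimension; the third is the divergence theorem on R^n. *)
Definition lebesgue_rV_spec n (mu : {measure set (borel 'rV[R]_n) -> \bar R}) :=
  [/\ forall f : borel 'rV[R]_n -> \bar R, (forall v, 0 <= f v)%E ->
        measurable_fun setT f -> (\int[mu]_v f v = lebesgue_int f)%E,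
      forall M : R, (mu [set v | (`|v| <= M)%R] < +oo)%E &
      forall (F : 'rV[R]_n -> R) i (M : R), (forall u, C1at F u) ->
        (forall u, M < `|u| -> F u = 0) ->
        (\int[mu]_v (pd i F v)%:E = 0)%E].

Lemma lebesgue_rV_step n (mu0 : {measure set (borel 'rV[R]_n) -> \bar R}) :
  lebesgue_rV_spec mu0 ->
  exists mu : {measure set (borel 'rV[R]_n.+1) -> \bar R}, lebesgue_rV_spec mu.
Proof.
move=> [intE fin div].
have sig : sigma_finite setT mu0.
  exists (fun k => [set v | `|v| <= k%:R]); last first.
    by move=> k; split; [exact: measurable_norm_le|exact: fin].
  apply/esym; rewrite -subTset => v _.
  exists (Num.bound `|v|) => //=; apply: ltW; apply: archi_boundP; exact: normr_ge0.
pose mu : {sigma_finite_measure set (borel 'rV[R]_n) -> \bar R} := sigma_finite_copy sig.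
pose la : {sigma_finite_measure set (measurableTypeR R) -> \bar R} := lambda.
pose pi : {measure set (measurableTypeR R * borel 'rV[R]_n) -> \bar R} := (la \x mu)%E.
pose nu : {measure set (borel 'rV[R]_n.+1) -> \bar R} :=
  measure_pushforward (@measurable_rV_cons R n) pi.
have cons_box M : (@rV_cons R n) @^-1` [set v | `|v| <= M] =
    [set` `[(- M)%R, M]] `*` [set v | `|v| <= M].
  apply/seteqP; split=> -[t v] /=; rewrite rV_cons_norm in_itv/= ler_norml.
    by move=> /andP[].
  by move=> [-> ->].
have pi_box M : (pi ((@rV_cons R n) @^-1` [set v | (`|v| <= M)%R]) < +oo)%E.
  rewrite cons_box [pi _]product_measure1E//; last exact: measurable_norm_le.
  have laM : lambda `[(- M)%R, M] \is a fin_num.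
    by rewrite lebesgue_measure_itv/=; case: ifPn.
  by apply: lte_mul_pinfty; [exact: measure_ge0|exact: laM|exact: fin].
exists nu; split.
- move=> f f0 mf.
  rewrite [LHS](ge0_integral_pushforward (@measurable_rV_cons R n))//.
  rewrite preimage_setT.
  rewrite [LHS]fubini_tonelli1//=; last first.
    exact: measurableT_comp mf (@measurable_rV_cons R n).
  apply: eq_integral => t _; rewrite /fubini_F /=.
  apply: intE => //.
  apply: (measurableT_comp mf).
  apply: (measurableT_comp (@measurable_rV_cons R n)).
  exact: pair1_measurable.
- by move=> M; exact: pi_box.
- move=> F i M cF F0.
  have mpd : measurable_fun setT (pd i F : borel 'rV[R]_n.+1 -> R).
    apply: (@continuous_at_measurable _ _ setT (pd i F)); first exact: openT.
    by move=> u _; apply: (cF u).2.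
  have mpdc : measurable_fun setT (pd i F \o (@rV_cons R n) : measurableTypeR R * borel 'rV[R]_n -> R).
    exact: measurableT_comp mpd (@measurable_rV_cons R n).
  have pdM := support_pd0 i F0.
  have [K KP] := continuous_compact_support_bounded (fun u => (cF u).2 i) pdM.
  have ipd : pi.-integrable setT (EFin \o (pd i F \o (@rV_cons R n))).
    apply: (bounded_support_integrable _ (pi_box M) mpdc).
    + rewrite -[X in measurable X]setTI; apply: (@measurable_rV_cons R n) => //.
      exact: measurable_norm_le.
    + by move=> p _; exact: KP.
    + by move=> p /= /negP; rewrite -ltNge => /pdM.
  rewrite [LHS](integral_pushforward (@measurable_rV_cons R n))//; last first.
    exact/measurable_EFinP.
  rewrite preimage_setT.
  (* Fubini is used in the order that makes the inner integral vanish: over the remaining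
     coordinates when [i] is one of them, by the induction hypothesis, and over the first coordinate
     otherwise, by the fundamental theorem of calculus. *)
  case: (unliftP ord0 i) => [j ij|i0].
  + rewrite -[LHS](integral12_prod_meas1 ipd).
    apply: integral0_eq => t _; rewrite /fubini_F /=.
    transitivity (\int[mu0]_v (pd j (fun w => F (rV_cons (t, w))) v)%:E)%E.
      by apply: eq_integral => v _; rewrite pd_rV_cons ij.
    apply: (div _ _ M) => [u|u Mu]; first exact: C1at_rV_cons.
    by apply: F0; rewrite ltNge rV_cons_norm negb_and -!ltNge Mu orbT.
  + rewrite -[LHS](integral21_prod_meas1 ipd).
    apply: integral0_eq => v _; rewrite /fubini_G /=.
    apply: (@integral_derive_compact_support _ (fun t => F (rV_cons (t, v)))
       (fun t => pd i F (rV_cons (t, v))) M).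
    * move=> t; under eq_fun do rewrite rV_cons_line0.
      rewrite (rV_cons_line0 t v) i0; apply: is_derive_line.
      have := cF (t *: delta_mx 0 ord0 + rV_cons (0, v)); exact: C1at_derivable.
    * move=> t; apply: (@continuous_comp _ _ _ (fun t => rV_cons (t, v))); last exact: (cF _).2.
      apply: differentiable_continuous.
      under eq_fun do rewrite rV_cons_line0.
      apply: differentiableD; last exact: differentiable_cst.
      by apply: (@differentiableZl _ _ _ id); apply: ex_diff.
    * move=> t Mt; apply: F0.
      by rewrite ltNge rV_cons_norm negb_and -!ltNge Mt.
Qed.

Lemma exists_lebesgue_rV n :
  exists mu : {measure set (borel 'rV[R]_n) -> \bar R}, lebesgue_rV_spec mu.
Proof.
elim: n => [|n [mu /lebesgue_rV_step]//].
(* In dimension 0 the space is a point, and there is no coordinate to differentiate in. *)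
exists (\d_(0 : borel 'rV[R]_0))%R; split => [f f0 mf|M|F []//].
  by rewrite integral_dirac// diracT mul1e.
by rewrite /dirac/= ltry.
Qed.

End LebesgueExists.

(** * Minimality and the divergence of the position vector *)

Section DeterminantDerivative.
Context {R : realType} {n : nat}.
Implicit Type u : 'rV[R]_n.

Lemma pd_prod k (I : eqType) (r : seq I) (F : I -> 'rV[R]_n -> R) u :
  uniq r -> (forall i, C1at (F i) u) ->
  pd k (fun w => \prod_(i <- r) F i w) u =
  \sum_(i <- r) pd k (F i) u * \prod_(j <- r | j != i) F j u.
Proof.
move=> + cF; elim: r => [_|i r IH /= /andP[ir ur]].
  rewrite big_nil -[RHS](pd_cst k 1 u); congr pd.
  by apply/funext => w; rewrite big_nil.
transitivity (pd k (fun w => F i w * \prod_(j <- r) F j w) u).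
  by congr pd; apply/funext => w; rewrite big_cons.
rewrite pdM; [|exact: C1at_diff|by apply: C1at_diff; exact: C1at_prod].
rewrite IH// !big_cons eqxx /= mulr_sumr; congr (_ * _ + _).
  rewrite [RHS]big_seq_cond [LHS]big_seq; apply: eq_bigl => j.
  by case: (boolP (j \in r)) => // jr /=; apply/esym; apply: contraNneq ir => <-.
rewrite [LHS]big_seq [RHS]big_seq; apply: eq_bigr => j jr.
have ij : i != j by apply: contraNneq ir => ->.
rewrite big_cons ij; exact: mulrCA.
Qed.

Lemma C1at_det p (M : 'rV[R]_n -> 'M[R]_p) u :
  (forall i j, C1at (fun w => M w i j) u) -> C1at (fun w => \det (M w)) u.
Proof.
move=> cM; apply: C1at_sum => s _; apply: C1atM; first exact: C1at_cst.
by apply: C1at_prod => i _; exact: cM.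
Qed.

Lemma C1at_cofactor p (M : 'rV[R]_n -> 'M[R]_p) i j u :
  (forall i j, C1at (fun w => M w i j) u) ->
  C1at (fun w => cofactor (M w) i j) u.
Proof.
move=> cM; apply: C1atM; first exact: C1at_cst.
apply: C1at_det => a b.
by apply: near_eq_C1at (cM (lift i a) (lift j b)); near=> w; rewrite !mxE.
Unshelve. all: by end_near. Qed.

(** Jacobi's formula. The Leibniz terms in which row [i] is differentiated form the determinant of
    [M u] with that row replaced by its derivative, which is then expanded along row [i]. *)
Lemma pd_det p (M : 'rV[R]_n -> 'M[R]_p) k u :
  (forall i j, C1at (fun w => M w i j) u) ->
  pd k (fun w => \det (M w)) u =
  \sum_i \sum_j pd k (fun w => M w i j) u * cofactor (M u) i j.
Proof.
move=> cM.
rewrite /determinant pd_sum; last first.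
  move=> s; apply: C1atM; first exact: C1at_cst.
  by apply: C1at_prod => i _; exact: cM.
under eq_bigr => s _.
  rewrite pdM; [|exact: differentiable_cst|]; last first.
    by apply: C1at_diff; apply: C1at_prod => i _; exact: cM.
  rewrite pd_cst mul0r add0r (@pd_prod _ _ _ (fun i w => M w i (s i))).
  2: exact: index_enum_uniq.
  2: by move=> i; exact: cM.
  rewrite mulr_sumr; over.
rewrite exchange_big /=; apply: eq_bigr => i _.
pose N := \matrix_(a, b) if a == i then pd k (fun w => M w i b) u else M u a b.
transitivity (\det N).
  apply: eq_bigr => s _; congr (_ * _); rewrite [RHS](bigD1 i)//= mxE eqxx.
  by congr (_ * _); apply: eq_bigr => j ji; rewrite mxE (negbTE ji).
rewrite (expand_det_row _ i); apply: eq_bigr => j _; rewrite mxE eqxx.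
congr (_ * (_ * \det _)); apply/matrixP => a b; rewrite !mxE.
by rewrite eq_sym (negbTE (neq_lift _ _)).
Qed.

End DeterminantDerivative.

(** * Gram matrices of free families *)

Section GramMatrix.
Context {R : realType}.

Lemma dotp_ge0 m (v : 'rV[R]_m) : 0 <= dotp v v.
Proof. by apply: sumr_ge0 => i _; rewrite -expr2 sqr_ge0. Qed.

Lemma dotp_eq0 m (v : 'rV[R]_m) : (dotp v v == 0) = (v == 0).
Proof.
rewrite psumr_eq0; last by move=> i _; rewrite -expr2 sqr_ge0.
apply/allP/eqP => [v0|-> i _]; last by rewrite /= mxE mul0r eqxx.
apply/rowP => i; have := v0 i (mem_index_enum i).
by rewrite /= mulf_eq0 orbb mxE => /eqP.
Qed.

Lemma dotpE m (v w : 'rV[R]_m) : dotp v w = (v *m w^T) 0 0.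
Proof. by rewrite mxE; apply: eq_bigr => i _; rewrite mxE. Qed.

(** A row vector [v] killed by J J^T satisfies |v J|^2 = 0, hence v J = 0, hence v = 0. *)
Lemma gram_unitmx n m (J : 'M[R]_(n, m)) : row_free J -> J *m J^T \in unitmx.
Proof.
move=> Jfree; rewrite -row_free_unit -kermx_eq0; apply/eqP/row_matrixP => i.
set v := row i _; have vG : v *m (J *m J^T) = 0.
  by rewrite -row_mul mulmx_ker row0.
have : v *m J == 0.
  by rewrite -dotp_eq0 dotpE trmx_mul !mulmxA -(mulmxA v) vG mul0mx mxE.
rewrite row0 => /eqP vJ; apply: (row_free_inj Jfree).
by rewrite mul0mx.
Qed.

(* The segment from the identity to the Gram matrix consists of invertible
   matrices, so the determinant cannot change sign along it. *)
Lemma det_gram_gt0 n m (J : 'M[R]_(n, m)) : row_free J -> 0 < \det (J *m J^T).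
Proof.
move=> Jfree; set G := J *m J^T.
pose Q : 'M[{poly R}]_n := (1 - 'X) *: 1%:M + 'X *: map_mx polyC G.
have QE t : (\det Q).[t] = \det ((1 - t) *: 1%:M + t *: G).
  rewrite -horner_evalE -det_map_mx; congr (\det _).
  apply/matrixP => i j; rewrite !mxE /= /horner_eval !hornerE.
  by case: (i == j); rewrite ?mulr1n ?mulr0n ?hornerE.
have detG : \det G != 0 by have := gram_unitmx Jfree; rewrite unitmxE unitfE.
rewrite lt_neqAle eq_sym detG /= leNgt; apply/negP => Glt0.
have [|t /andP[t0 t1]] := @poly_ivt R (- \det Q) 0 1 ler01.
  rewrite !hornerN !QE subr0 scale1r scale0r addr0 det1 subrr scale0r add0r.
  by rewrite scale1r oppr_le0 ler01 oppr_ge0 ltW.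
rewrite rootN /root QE => /det0P[v v0].
rewrite mulmxDr -!scalemxAr mulmx1 => vE.
have : (1 - t) * dotp v v + t * dotp (v *m J) (v *m J) = 0.
  have := congr1 (fun w : 'rV_n => (w *m v^T) 0 0) vE.
  have -> : dotp (v *m J) (v *m J) = (v *m G *m v^T) 0 0.
    by rewrite dotpE trmx_mul /G !mulmxA.
  rewrite dotpE mulmxDl -!scalemxAl mul0mx.
  by move: (v *m v^T) (v *m G *m v^T) => M N; rewrite !mxE.
move/eqP; rewrite paddr_eq0 ?mulr_ge0 ?dotp_ge0 ?subr_ge0//.
rewrite !mulf_eq0 !dotp_eq0 (negbTE v0) orbF subr_eq0 => /andP[/eqP <-].
rewrite oner_eq0 /= => /eqP vJ; move/negP: v0; apply.
by apply/eqP/(row_free_inj Jfree); rewrite mul0mx.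
Qed.

End GramMatrix.

(** * The divergence of x^T in one coordinate system *)

Section TangentDivergence.
Context {R : realType} {n m : nat}.
Variables (X : 'I_m -> 'rV[R]_n -> R) (J : 'rV[R]_n -> 'M[R]_(n, m)).
Variable u : 'rV[R]_n.
Hypothesis X_diff : forall k, \forall w \near u, differentiable (X k) w.
Hypothesis J_pd : \forall w \near u, forall l k, J w l k = pd l (X k) w.
Hypothesis J_C1 : forall l k, C1at (fun w => J w l k) u.
Hypothesis J_free : \forall w \near u, row_free (J w).

Let G w := J w *m (J w)^T.
Let s w := Num.sqrt (\det (G w)).
Let P w := invmx (G w).
(** The second derivatives of [X], since [J] is the matrix of its first derivatives near [u]. *)
Let h i l k := pd i (fun w => J w l k) u.

Let Jfree : row_free (J u). Proof. exact: nbhs_singleton J_free. Qed.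
Let detG0 : 0 < \det (G u). Proof. exact: det_gram_gt0. Qed.
Let Gunit : G u \in unitmx. Proof. exact: gram_unitmx. Qed.
Let s0 : s u != 0. Proof. by rewrite gt_eqF// sqrtr_gt0. Qed.

Let GE w i j : G w i j = \sum_k J w i k * J w j k.
Proof. by rewrite mxE; apply: eq_bigr => k _; rewrite mxE. Qed.

Let GT w : (G w)^T = G w. Proof. by rewrite /G trmx_mul trmxK. Qed.

Let PT w i j : P w i j = P w j i.
Proof.
have /matrixP/(_ j i) : (P w)^T = P w by rewrite /P trmx_inv GT.
by rewrite [in X in X -> _]mxE.
Qed.

Let h_sym i l k : h i l k = h l i k.
Proof.
have Jl a : \forall w \near u, J w a k = pd a (X k) w.
  by apply: filterS J_pd => w.
rewrite /h (near_eq_pd _ (Jl l)) (near_eq_pd _ (Jl i)); apply: pd_comm => //.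
- exact: near_eq_C1at (Jl i) (J_C1 i k).
- exact: near_eq_C1at (Jl l) (J_C1 l k).
Qed.

Lemma C1at_metric i j : C1at (fun w => G w i j) u.
Proof.
have : C1at (fun w => \sum_k J w i k * J w j k) u.
  by apply: C1at_sum => k _; exact: C1atM.
by apply: near_eq_C1at; near=> w; rewrite GE.
Unshelve. all: by end_near. Qed.

Let C1at_detG : C1at (fun w => \det (G w)) u.
Proof. by apply: C1at_det => i j; exact: C1at_metric. Qed.

Lemma C1at_volume_density : C1at s u.
Proof. exact: C1at_sqrt. Qed.

Lemma C1at_inverse_metric i j : C1at (fun w => P w i j) u.
Proof.
have : C1at (fun w => (\det (G w))^-1 * cofactor (G w) j i) u.
  apply: C1atM; first by apply: C1atV => //; rewrite gt_eqF.
  by apply: C1at_cofactor => a b; exact: C1at_metric.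
apply: near_eq_C1at; apply: filterS J_free => w Jw.
(* The adjugate formula for [invmx] holds only on invertible matrices, hence the restriction to
   points where the frame is free. *)
by rewrite /P /invmx gram_unitmx// !mxE.
Qed.

Let pdM1 l f g : C1at f u -> C1at g u ->
  pd l (fun w => f w * g w) u = pd l f u * g u + f u * pd l g u.
Proof. by move=> cf cg; apply: pdM; exact: C1at_diff. Qed.

Let pd_metric l i j : pd l (fun w => G w i j) u =
  \sum_k (h l i k * J u j k + J u i k * h l j k).
Proof.
have -> : (fun w => G w i j) = (fun w => \sum_k J w i k * J w j k).
  by apply/funext => w; rewrite GE.
rewrite pd_sum; last by move=> k; exact: (C1atM (J_C1 i k) (J_C1 j k)).
by apply: eq_bigr => k _; rewrite (pdM1 l (J_C1 i k) (J_C1 j k)).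
Qed.

(** By Jacobi's formula d_l s is half of s tr (P d_l G). The two terms of d_l (J J^T) contribute
    equally because [P] is symmetric, and this cancels the half. *)
Lemma pd_volume_density l :
  pd l s u = s u * \sum_i \sum_j P u i j * \sum_k J u j k * h l i k.
Proof.
rewrite (pd_sqrt l detG0 (C1at_diff C1at_detG)) (pd_det l C1at_metric).
set T := \sum_i \sum_j P u i j * _.
have TE : T = \sum_i \sum_j P u i j * \sum_k J u i k * h l j k.
  rewrite /T exchange_big; apply: eq_bigr => i _; apply: eq_bigr => j _.
  by rewrite PT.
have -> : \sum_i \sum_j pd l (fun w => G w i j) u * cofactor (G u) i j =
    \det (G u) * (T + T).
  rewrite mulrDr [in X in _ = _ + X]TE /T !mulr_sumr -big_split.
  apply: eq_bigr => i _ /=.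
  rewrite !mulr_sumr -big_split; apply: eq_bigr => j _ /=.
  have -> : cofactor (G u) i j = \det (G u) * P u i j.
    rewrite PT /P /invmx Gunit [in RHS]mxE [\adj _ _ _]mxE mulrA mulfV ?mul1r//.
    by rewrite gt_eqF.
  rewrite pd_metric big_split /=.
  have -> : \sum_k h l i k * J u j k = \sum_k J u j k * h l i k.
    by apply: eq_bigr => k _; exact: mulrC.
  ring.
rewrite -{2}(sqr_sqrtr (ltW detG0)) -/(s u) expr2.
by clearbody T; field.
Qed.

(** The density times the frame dual to the coordinate tangent vectors, that is sqrt (det g) g^ij
    d_j X_k. *)
Let Y i k w := s w * \sum_j P w i j * J w j k.

Let C1at_Y i k : C1at (Y i k) u.
Proof.
apply: C1atM; first exact: C1at_volume_density.
by apply: C1at_sum => j _; exact: (C1atM (C1at_inverse_metric i j) (J_C1 j k)).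
Qed.

Let Y_dual i l : \forall w \near u, \sum_k Y i k w * J w l k = s w *+ (i == l).
Proof.
apply: filterS J_free => w Jw.
have -> : s w *+ (i == l) = s w * (P w *m G w) i l.
  by rewrite /P mulVmx ?gram_unitmx// mxE mulr_natr.
rewrite mxE mulr_sumr.
under [RHS]eq_bigr do rewrite GE mulr_sumr mulr_sumr.
rewrite exchange_big; apply: eq_bigr => k _ /=.
rewrite /Y mulr_sumr mulr_suml; apply: eq_bigr => j _.
by rewrite -!mulrA; congr (_ * (_ * _)); rewrite mulrC.
Qed.

Let dY k := \sum_i pd i (Y i k) u.

(** Differentiating [Y_dual] gives <dY, d_l> = d_l s - sum_i <Y i, h i l>. After exchanging the two
    derivatives in [h], [pd_volume_density] says that the right-hand side is zero. *)
Let dY_tangent l : \sum_k dY k * J u l k = 0.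
Proof.
have E i : \sum_k pd i (Y i k) u * J u l k =
    (pd i s u) *+ (i == l) - \sum_k Y i k u * h i l k.
  apply/eqP; rewrite eq_sym subr_eq -big_split /=; apply/eqP.
  transitivity (pd i (fun w => \sum_k Y i k w * J w l k) u).
    rewrite (near_eq_pd _ (Y_dual i l)); case: (i == l) => //.
    by rewrite mulr0n -[LHS](pd_cst i 0 u).
  rewrite pd_sum; last by move=> k; exact: (C1atM (C1at_Y i k) (J_C1 l k)).
  by apply: eq_bigr => k _; rewrite (pdM1 i (C1at_Y i k) (J_C1 l k)).
rewrite /dY; under eq_bigr do rewrite mulr_suml.
rewrite exchange_big; under eq_bigr do rewrite E.
rewrite sumrB (bigD1 l)//= eqxx big1 ?addr0; last first.
  by move=> i /negbTE ->.
rewrite pd_volume_density mulr_sumr; apply/eqP; rewrite subr_eq0; apply/eqP.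
apply: eq_bigr => i _; rewrite /Y mulr_sumr.
under [RHS]eq_bigr do rewrite mulr_sumr mulr_suml.
rewrite exchange_big; apply: eq_bigr => j _; rewrite !mulr_sumr.
apply: eq_bigr => k _; rewrite h_sym; ring.
Qed.

(** [nu] is a constant vector, orthogonal to the tangent space at [u] only. In the product rule for
    s P_ij <d_j, nu> the terms with the undifferentiated factor <d_j, nu> vanish at [u], and the
    others form the trace of the second fundamental form; no normal field is needed. *)
Let dY_normal (nu : 'rV[R]_m) : (forall l, \sum_k J u l k * nu 0 k = 0) ->
  \sum_k dY k * nu 0 k =
  s u * \sum_i \sum_j (\sum_k h i j k * nu 0 k) * P u j i.
Proof.
move=> nuJ; rewrite /dY; under eq_bigr do rewrite mulr_suml.
rewrite exchange_big mulr_sumr; apply: eq_bigr => i _ /=.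
pose Q j w := s w * P w i j.
pose N j w := \sum_k J w j k * nu 0 k.
have cQ j : C1at (Q j) u.
  by apply: C1atM; [exact: C1at_volume_density|exact: C1at_inverse_metric].
have cN j : C1at (N j) u.
  by apply: C1at_sum => k _; exact: (C1atM (J_C1 j k) (C1at_cst _ u)).
transitivity (pd i (fun w => \sum_j Q j w * N j w) u).
  transitivity (pd i (fun w => \sum_k Y i k w * nu 0 k) u).
    have cYnu k := C1atM (C1at_Y i k) (C1at_cst (nu 0 k) u).
    rewrite pd_sum//; apply: eq_bigr => k _.
    by rewrite (pdM1 i (C1at_Y i k) (C1at_cst (nu 0 k) u)) pd_cst mulr0 addr0.
  congr pd; apply/funext => w; rewrite /Y.
  under eq_bigr do rewrite mulr_sumr mulr_suml.
  rewrite exchange_big; apply: eq_bigr => j _; rewrite /Q /N mulr_sumr.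
  by apply: eq_bigr => k _; rewrite !mulrA.
rewrite pd_sum; last by move=> j; exact: (C1atM (cQ j) (cN j)).
rewrite mulr_sumr; apply: eq_bigr => j _; rewrite (pdM1 i (cQ j) (cN j)).
rewrite [N j u]nuJ mulr0 add0r /Q PT -mulrA; congr (_ * _).
rewrite mulrC; congr (_ * _).
have cJnu k := C1atM (J_C1 j k) (C1at_cst (nu 0 k) u).
rewrite pd_sum//; apply: eq_bigr => k _.
by rewrite (pdM1 i (J_C1 j k) (C1at_cst (nu 0 k) u)) pd_cst mulr0 addr0.
Qed.

Hypothesis minimal_u : forall nu : 'rV[R]_m, enorm nu = 1 ->
  (forall l, \sum_k J u l k * nu 0 k = 0) ->
  \sum_i \sum_j (\sum_k h i j k * nu 0 k) * P u j i = 0.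

Let dY_eq0 k : dY k = 0.
Proof.
pose w : 'rV[R]_m := \row_k dY k.
suff : w = 0 by move=> /rowP/(_ k); rewrite !mxE.
apply: contrapT => /eqP w0.
have nw : 0 < enorm w by rewrite sqrtr_gt0 lt_neqAle eq_sym dotp_eq0 w0 dotp_ge0.
pose nu := (enorm w)^-1 *: w.
have nu1 : enorm nu = 1.
  have -> : enorm nu = Num.sqrt (((enorm w)^-1 * enorm w) ^+ 2).
    rewrite exprMn [X in _ * X]sqr_sqrtr ?dotp_ge0//; congr Num.sqrt.
    rewrite /dotp mulr_sumr; apply: eq_bigr => i _; rewrite !mxE.
    by rewrite expr2 mulrACA.
  by rewrite mulVf ?expr1n ?sqrtr1// gt_eqF.
have nuE k0 : nu 0 k0 = (enorm w)^-1 * dY k0 by rewrite !mxE.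
have nuJ l : \sum_k J u l k * nu 0 k = 0.
  transitivity ((enorm w)^-1 * \sum_k dY k * J u l k); last first.
    by rewrite dY_tangent mulr0.
  by rewrite mulr_sumr; apply: eq_bigr => k0 _; rewrite nuE; ring.
have := dY_normal nuJ; rewrite (minimal_u nu1 nuJ) mulr0.
move=> E; have : dotp w w = 0.
  have -> : dotp w w = enorm w * \sum_k dY k * nu 0 k; last by rewrite E mulr0.
  rewrite /dotp mulr_sumr; apply: eq_bigr => k0 _; rewrite nuE !mxE.
  by field; rewrite gt_eqF.
by move/eqP; rewrite dotp_eq0 (negbTE w0).
Qed.

(* Both sides are the coordinate form of [div x^T = n], multiplied by the volume
   density. The vector [dY] is the density times the Laplacian of [X]: it is
   orthogonal to the tangent space, and minimality applied to its own
   direction shows that it vanishes. *)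
Lemma divergence_tangent_position :
  \sum_i pd i (fun w => s w * \sum_j P w i j * \sum_k X k w * J w j k) u =
  n%:R * s u.
Proof.
have cX k : differentiable (X k) u by exact: nbhs_singleton (X_diff k).
(* The field is sum_k X_k Y_ik. Differentiating X_k gives <d_i, Y i> = s for each [i];
   differentiating Y_ik leaves <X, dY> after summation. *)
have E i : pd i (fun w => s w * \sum_j P w i j * \sum_k X k w * J w j k) u =
    s u + \sum_k X k u * pd i (Y i k) u.
  transitivity (pd i (fun w => \sum_k X k w * Y i k w) u).
    congr pd; apply/funext => w; rewrite mulr_sumr.
    under [LHS]eq_bigr do rewrite !mulr_sumr.
    rewrite exchange_big; apply: eq_bigr => k _ /=.
    rewrite /Y !mulr_sumr; apply: eq_bigr => j _; ring.
  have cX1 k : C1at (X k) u.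
    apply: (@C1atP _ _ _ (fun i w => J w i k)) => //.
      by apply: filterS J_pd => w Jw l; rewrite Jw.
    by move=> l; exact: C1at_continuous.
  rewrite pd_sum; last by move=> k; exact: (C1atM (cX1 k) (C1at_Y i k)).
  have := nbhs_singleton (Y_dual i i); rewrite eqxx mulr1n => <-.
  rewrite -big_split; apply: eq_bigr => k _.
  rewrite (pdM1 i (cX1 k) (C1at_Y i k)).
  by rewrite (nbhs_singleton J_pd) mulrC.
under eq_bigr do rewrite E.
rewrite big_split /= sumr_const card_ord mulr_natl -[RHS]addr0; congr (_ + _).
rewrite exchange_big big1// => k _.
by rewrite -mulr_sumr -/(dY k) dY_eq0 mulr0.
Qed.

End TangentDivergence.

(** * Integration on the hypersurface *)

Section DensityTransfer.
Context d1 d2 (X : measurableType d1) (T : measurableType d2) (R : realType).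
Variables (vol : {measure set X -> \bar R}) (mu : {measure set T -> \bar R}).
Variables (D : set X) (inv : T -> X) (w : T -> R).
Hypothesis mD : measurable D.
Hypothesis w_ge0 : forall u, 0 <= w u.
Hypothesis mw : forall E, measurable E ->
  measurable_fun setT (fun u => \1_E (inv u) * w u).
Hypothesis volE : forall E, measurable E ->
  vol (E `&` D) = (\int[mu]_u (\1_E (inv u) * w u)%:E)%E.

Import HBNNSimple.

Let simple_E (h : {nnsfun X >-> R}) u : (h (inv u) * w u)%:E =
  (\sum_(y \in range h) y%:E * (\1_(h @^-1` [set y]) (inv u) * w u)%:E)%E.
Proof.
rewrite EFinM fimfunE -fsumEFin// ge0_mule_fsuml.
  by apply: eq_fsbigr => y _; rewrite !EFinM muleA.
by move=> y; rewrite EFinM; exact: nnfun_muleindic_ge0.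
Qed.

Let simple_measurable (h : {nnsfun X >-> R}) :
  measurable_fun setT (fun u => (h (inv u) * w u)%:E).
Proof.
rewrite (_ : (fun u => _) = (fun u =>
  \sum_(y \in range h) y%:E * (\1_(h @^-1` [set y]) (inv u) * w u)%:E)%E).
  apply: emeasurable_fsum => // y; apply/measurable_funeM/measurable_EFinP.
  by apply: mw.
by apply/funext => u; rewrite simple_E.
Qed.

Let simple_integral (h : {nnsfun X >-> R}) :
  (\int[vol]_(p in D) (h p)%:E = \int[mu]_u (h (inv u) * w u)%:E)%E.
Proof.
transitivity (\sum_(y \in range h) y%:E * vol (h @^-1` [set y] `&` D))%E.
  under eq_integral do rewrite fimfunE -fsumEFin//.
  rewrite ge0_integral_fsum//; last 2 first.
  - by move=> y; apply/measurable_EFinP; apply: measurable_funM.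
  - by move=> y p _; rewrite EFinM nnfun_muleindic_ge0.
  apply: eq_fsbigr => y; rewrite inE => -[p _ <-{y}].
  under eq_integral do rewrite EFinM.
  rewrite ge0_integralZl//.
  - by rewrite integral_indic.
  - by apply/measurable_EFinP; exact: measurable_funTS.
  - by rewrite lee_fin.
under [RHS]eq_integral do rewrite simple_E.
rewrite ge0_integral_fsum//; last 2 first.
- by move=> y; apply/measurable_funeM/measurable_EFinP; apply: mw.
- move=> y u _; rewrite EFinM muleA mule_ge0 ?lee_fin//.
  exact: nnfun_muleindic_ge0.
apply: eq_fsbigr => y; rewrite inE => -[p _ <-{y}].
rewrite ge0_integralZl//.
- by congr (_ * _)%E; apply: volE.
- by apply/measurable_EFinP; apply: mw.
- by move=> u _; rewrite lee_fin mulr_ge0.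
- by rewrite lee_fin.
Qed.

(** Passage from sets to simple functions to monotone limits. Measurability is only asked of
    products with [w], because [inv] stands for the inverse of a chart, whose values outside the
    chart codomain are arbitrary. *)
Lemma ge0_integral_density (h : X -> \bar R) :
  measurable_fun setT h -> (forall p, 0 <= h p)%E ->
  (\int[vol]_(p in D) h p = \int[mu]_u (h (inv u) * (w u)%:E))%E.
Proof.
move=> mh h0; pose a := nnsfun_approx measurableT mh.
have ah p : EFin \o a^~ p @ \oo --> h p by exact: cvg_nnsfun_approx.
have nda p n m : (n <= m)%N -> a n p <= a m p.
  by move=> nm; exact/lefP/nd_nnsfun_approx.
transitivity (limn (fun n => \int[vol]_(p in D) (a n p)%:E))%E.
  rewrite -monotone_convergence//.
  - by apply: eq_integral => p _; apply/esym/cvg_lim => //; exact: ah.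
  - by move=> n; apply/measurable_EFinP; exact: measurable_funTS.
  - by move=> n p _; rewrite lee_fin.
  - by move=> p _ n m nm; rewrite lee_fin nda.
transitivity (limn (fun n => \int[mu]_u (a n (inv u) * w u)%:E))%E.
  by congr (limn _); apply/funext => n; exact: simple_integral.
rewrite -monotone_convergence//.
- apply: eq_integral => u _; apply/cvg_lim => //.
  rewrite (_ : (fun n => _) = (fun n => (EFin \o a^~ (inv u)) n * (w u)%:E)%E).
    by apply: cvgeZr => //; exact: ah.
  by apply/funext => n; rewrite EFinM.
- by move=> n u _; rewrite lee_fin mulr_ge0.
- by move=> u _ n m nm; rewrite lee_fin ler_wpM2r// nda.
Qed.

End DensityTransfer.

Section ChartBasics.
Context {R : realType} {n : nat} {S : ptopologicalType}.
Implicit Types (c d : chart R n S).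

Lemma chart_cod_openE c : open (chart_cod c).
Proof. exact: chart_cod_open. Qed.

Lemma chart_codP c p : chart_dom c p -> chart_cod c (c p).
Proof. by move=> cp; exists p. Qed.

Lemma chart_inv_dom c u : chart_cod c u -> chart_dom c (chart_inv c u).
Proof. by move=> [p cp <-]; rewrite chart_mapK. Qed.

Lemma chart_invK c u : chart_cod c u -> c (chart_inv c u) = u.
Proof. by move=> [p cp <-]; rewrite chart_mapK. Qed.

Lemma chart_inv_continuous_at c u : chart_cod c u ->
  {for u, continuous (chart_inv c)}.
Proof.
move=> cu; have := @chart_inv_continuous _ _ _ c.
rewrite continuous_open_subspace; last exact: chart_cod_open.
by apply; rewrite inE.
Qed.

Lemma chart_map_continuous_at c p : chart_dom c p ->
  {for p, continuous (chart_map c)}.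
Proof.
move=> cp; have := @chart_map_continuous _ _ _ c.
rewrite continuous_open_subspace; last exact: chart_dom_open.
by apply; rewrite inE.
Qed.

Lemma near_chart_cod c u : chart_cod c u -> \forall w \near u, chart_cod c w.
Proof. by move=> cu; apply: open_nbhs_nbhs; split=> //; exact: chart_cod_openE. Qed.

Lemma near_chart_dom c p : chart_dom c p -> \forall q \near p, chart_dom c q.
Proof. by move=> cp; apply: open_nbhs_nbhs; split=> //; exact: chart_dom_open. Qed.

Lemma near_chart_inv c u (P : S -> Prop) : chart_cod c u ->
  (\forall q \near chart_inv c u, P q) -> \forall w \near u, P (chart_inv c w).
Proof. by move=> /chart_inv_continuous_at ci; exact: ci. Qed.

Lemma near_chart_overlap c d p : chart_dom c p -> chart_dom d p ->
  \forall w \near c p, (c @` (chart_dom c `&` chart_dom d)) w.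
Proof.
move=> cp dp.
have : \forall w \near c p, chart_dom d (chart_inv c w).
  apply: near_chart_inv; first exact: chart_codP.
  by rewrite chart_mapK//; exact: near_chart_dom.
have := near_chart_cod (chart_codP cp).
apply: filterS2 => w cw dw; exists (chart_inv c w); last exact: chart_invK.
by split=> //; exact: chart_inv_dom.
Qed.

Lemma measurable_chart_dom c : measurable (chart_dom c : set (borel S)).
Proof. by apply: borel_open; exact: chart_dom_open. Qed.

Lemma measurable_chart_cod c : measurable (chart_cod c : set (borel 'rV[R]_n)).
Proof. by apply: borel_open; exact: chart_cod_openE. Qed.

Lemma measurable_chart_inv c :
  measurable_fun (chart_cod c : set (borel 'rV[R]_n)) (chart_inv c : _ -> borel S).
Proof.
apply: (@measurability _ _ (borel 'rV[R]_n) (borel S) _ _ (@open S)) => //.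
move=> _ [U oU <-]; apply: borel_open; rewrite openE => u [cu Uu].
apply: filterI; first exact: near_chart_cod.
by apply: (chart_inv_continuous_at cu); exact: open_nbhs_nbhs.
Qed.

Lemma chart_imageE c (E : set S) :
  c @` (E `&` chart_dom c) = chart_cod c `&` chart_inv c @^-1` E.
Proof.
apply/seteqP; split => [_ [p [Ep cp] <-]|u [cu Eu]].
  by split; [exact: chart_codP|rewrite /= chart_mapK].
exists (chart_inv c u); last exact: chart_invK.
by split=> //; exact: chart_inv_dom.
Qed.

Lemma measurable_chart_image c (E : set (borel S)) : measurable E ->
  measurable (c @` (E `&` chart_dom c) : set (borel 'rV[R]_n)).
Proof.
move=> mE; rewrite chart_imageE; apply: measurable_chart_inv => //.
exact: measurable_chart_cod.
Qed.

Lemma chart_compact_image c (Q : set 'rV[R]_n) : compact Q ->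
  Q `<=` chart_cod c -> compact (chart_inv c @` Q).
Proof.
move=> cQ Qc; apply: continuous_compact => //.
apply: continuous_in_subspaceT => u; rewrite inE => Qu.
by apply: chart_inv_continuous_at; exact: Qc.
Qed.

End ChartBasics.

Section Hypersurface.
Context {R : realType} {n : nat} {S : ptopologicalType}.
Variables (A : set (chart R n S)) (x : S -> 'rV[R]_n.+1).
Hypothesis immersion_x : smooth_immersion A x.

Section Chart.
Variables (c : chart R n S) (Ac : A c).

Let Xdiff u : chart_cod c u -> differentiable (param x c) u.
Proof. by move=> cu; have [/(_ 1%N)[+ _] _] := immersion_x Ac; exact. Qed.

Local Notation coord k := (fun w : 'rV[R]_n => param x c w 0 k).
Local Notation J := (tangent_frame x c).

Let coord_diff_at u k : chart_cod c u -> differentiable (coord k) u.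
Proof.
move=> cu; apply: (@differentiable_comp _ _ _ _ (param x c)
  (fun v : 'rV[R]_n.+1 => v 0 k)); first exact: Xdiff.
exact: differentiable_coord.
Qed.

Lemma near_coord_differentiable u k : chart_cod c u ->
  \forall w \near u, differentiable (coord k) w.
Proof.
move=> /near_chart_cod; apply: filterS => w; exact: coord_diff_at.
Qed.

Lemma partial_coord i k u : chart_cod c u ->
  partial i (param x c) u 0 k = pd i (coord k) u.
Proof.
move=> cu; rewrite /partial derive_mx; last exact/diff_derivable/Xdiff.
by rewrite mxE.
Qed.

Lemma tangent_frame_partial l u : chart_cod c u ->
  row l (J u) = partial l (param x c) u.
Proof.
by move=> cu; rewrite rowE /tangent_frame -deriveEjacobian; [|exact: Xdiff].
Qed.

Lemma tangent_frameE l k u : chart_cod c u -> J u l k = pd l (coord k) u.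
Proof.
by move=> cu; rewrite -partial_coord// -tangent_frame_partial// [RHS]mxE.
Qed.

Lemma near_tangent_frameE u : chart_cod c u ->
  \forall w \near u, forall l k, J w l k = pd l (coord k) w.
Proof.
by move=> /near_chart_cod; apply: filterS => w cw l k; exact: tangent_frameE.
Qed.

Lemma C1at_tangent_frame l k u : chart_cod c u -> C1at (fun w => J w l k) u.
Proof.
move=> cu; have [/(_ 2%N)[_ /(_ l)[dX cX]] _] := immersion_x Ac.
have : C1at (fun w => partial l (param x c) w 0 k) u.
  apply: (@C1at_comp _ _ _ (fun v : 'rV[R]_n.+1 => v 0 k)).
  - exact: C1at_coord.
  - by apply: filterS (near_chart_cod cu) => w; exact: dX.
  - by move=> i; exact: cX.
apply: near_eq_C1at; apply: filterS (near_chart_cod cu) => w cw.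
by rewrite -tangent_frame_partial// [LHS]mxE.
Qed.

Lemma near_tangent_frame_free u : chart_cod c u ->
  \forall w \near u, row_free (J w).
Proof.
have [_ fJ] := immersion_x Ac.
by move=> /near_chart_cod; apply: filterS => w; exact: fJ.
Qed.

Lemma partial2_coord i j k u : chart_cod c u ->
  partial i (partial j (param x c)) u 0 k = pd i (fun w => J w j k) u.
Proof.
move=> cu; have [/(_ 2%N)[_ /(_ j)[dX _]] _] := immersion_x Ac.
rewrite /partial derive_mx; last exact/diff_derivable/dX.
rewrite mxE; apply: near_eq_pd; apply: filterS (near_chart_cod cu) => w cw.
transitivity (row j (J w) 0 k); last by rewrite mxE.
by rewrite tangent_frame_partial.
Qed.

End Chart.
End Hypersurface.

Section ChartGeometry.
Context {R : realType} {n : nat} {S : ptopologicalType}.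
Variables (A : set (chart R n S)) (x : S -> 'rV[R]_n.+1).
Hypothesis immersion_x : smooth_immersion A x.

(* The coordinates of x^T in the frame of coordinate tangent vectors. *)
Definition tangent_coef (c : chart R n S) (i : 'I_n) (u : 'rV[R]_n) : R :=
  \sum_j invmx (metric x c u) i j *
    \sum_k param x c u 0 k * tangent_frame x c u j k.

Section Chart.
Variables (c : chart R n S) (Ac : A c).

Lemma C1at_param_coord k u : chart_cod c u ->
  C1at (fun w => param x c w 0 k) u.
Proof.
move=> cu; apply: (@C1atP _ _ _ (fun i w => tangent_frame x c w i k)).
- exact: (near_coord_differentiable immersion_x Ac).
- by apply: filterS (near_tangent_frameE immersion_x Ac cu) => w E i; rewrite E.
- move=> i; apply: C1at_continuous.
  exact: (C1at_tangent_frame immersion_x Ac).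
Qed.

Lemma C1at_chart_density u : chart_cod c u -> C1at (volume_density x c) u.
Proof.
move=> cu; apply: (@C1at_volume_density _ _ _ (tangent_frame x c)).
- by move=> l k; exact: (C1at_tangent_frame immersion_x Ac).
- exact: (near_tangent_frame_free immersion_x Ac).
Qed.

Lemma C1at_tangent_coef i u : chart_cod c u -> C1at (tangent_coef c i) u.
Proof.
move=> cu; have cJ l k : C1at (fun w => tangent_frame x c w l k) u.
  exact: (C1at_tangent_frame immersion_x Ac).
apply: C1at_sum => j _; apply: C1atM.
  apply: (@C1at_inverse_metric _ _ _ (tangent_frame x c) _ cJ).
  exact: (near_tangent_frame_free immersion_x Ac).
by apply: C1at_sum => k _; apply: C1atM (cJ j k); exact: C1at_param_coord.
Qed.

Lemma divergence_chart u : minimal A x -> chart_cod c u ->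
  \sum_i pd i (fun w => volume_density x c w * tangent_coef c i w) u =
  n%:R * volume_density x c u.
Proof.
move=> min cu.
apply: (@divergence_tangent_position _ _ _
  (fun k w => param x c w 0 k) (tangent_frame x c)).
- by move=> k; exact: (near_coord_differentiable immersion_x Ac).
- exact: (near_tangent_frameE immersion_x Ac).
- by move=> l k; exact: (C1at_tangent_frame immersion_x Ac).
- exact: (near_tangent_frame_free immersion_x Ac).
move=> nu nu1 nuJ; have : mean_curvature x c u nu = 0.
  apply: (min _ _ _ Ac cu); split=> // l; rewrite /dotp -[RHS](nuJ l).
  by apply: eq_bigr => k _; rewrite [row _ _ _ _]mxE.
move=> H0; transitivity (mean_curvature x c u nu); last exact: H0.
rewrite /mean_curvature /mxtrace. apply: eq_bigr => i _.
rewrite [RHS]mxE; apply: eq_bigr => j _; congr (_ * _).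
rewrite [RHS]mxE; apply: eq_bigr => k _; congr (_ * _).
by rewrite (partial2_coord immersion_x Ac).
Qed.

Lemma metric_unitmx u : chart_cod c u -> metric x c u \in unitmx.
Proof.
by move=> cu; apply: gram_unitmx; have [_] := immersion_x Ac; exact.
Qed.

Lemma inv_metricT u : (invmx (metric x c u))^T = invmx (metric x c u).
Proof. by rewrite trmx_inv /metric trmx_mul trmxK. Qed.

Lemma tangent_coefE i u : tangent_coef c i u =
  (param x c u *m (tangent_frame x c u)^T *m invmx (metric x c u)) 0 i.
Proof.
have PT j : invmx (metric x c u) i j = invmx (metric x c u) j i.
  by rewrite -[in LHS]inv_metricT [LHS]mxE.
rewrite [RHS]mxE; apply: eq_bigr => j _; rewrite PT mulrC; congr (_ * _).
rewrite [RHS]mxE; apply: eq_bigr => k _.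
by rewrite [(tangent_frame x c u)^T _ _]mxE.
Qed.

Lemma tangent_coef_proj u k :
  \sum_i tangent_coef c i u * tangent_frame x c u i k =
  tangent_proj x c u (param x c u) 0 k.
Proof.
by rewrite [RHS]mxE; apply: eq_bigr => i _; rewrite tangent_coefE.
Qed.

(** The matrix J^T g^-1 J is symmetric and idempotent, hence an orthogonal projection; for v = x
    this gives <x, x^T> = |x^T|^2 = |x|^2 - |x^perp|^2. *)
Lemma dotp_tangent_proj u v : chart_cod c u ->
  let pv := tangent_proj x c u v in
  dotp v pv = dotp pv pv /\ dotp v pv = dotp v v - dotp (v - pv) (v - pv).
Proof.
move=> cu pv; set J := tangent_frame x c u; set P := invmx (metric x c u).
have PT : P^T = P by exact: inv_metricT.
have pvT : pv^T = J^T *m P *m J *m v^T.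
  by rewrite /pv /tangent_proj -/J -/P !trmx_mul trmxK PT !mulmxA.
have pp : pv *m pv^T = v *m pv^T.
  rewrite pvT /pv /tangent_proj -/J -/P -!mulmxA; congr (v *m (_ *m _)).
  rewrite !mulmxA -(mulmxA P J) -[J *m J^T]/(metric x c u).
  by rewrite mulVmx ?metric_unitmx// mul1mx.
have vp : pv *m v^T = v *m pv^T.
  by rewrite pvT /pv /tangent_proj -/J -/P !mulmxA.
have E1 : dotp v pv = dotp pv pv by rewrite !dotpE pp.
split=> //; rewrite !dotpE linearB /= mulmxBl !mulmxBr pp vp subrr subr0.
by move: (v *m v^T) (v *m pv^T) => M N; rewrite !mxE opprB addrC subrK.
Qed.

End Chart.

Section Volume.
Variable vol : {measure set (g_sigma_algebraType (@open S)) -> \bar R}.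
Hypothesis vol_g : volume_measure A x vol.
Variable mu : {measure set (borel 'rV[R]_n) -> \bar R}.
Hypothesis mu_lebesgue : lebesgue_rV_spec mu.
Variables (c : chart R n S) (Ac : A c).

(** The indicator removes the meaningless values of the density outside the chart codomain, so that
    integrals run over all of R^n. *)
Definition chart_weight (u : 'rV[R]_n) : R :=
  \1_(chart_cod c) u * volume_density x c u.

Lemma chart_weight_ge0 u : 0 <= chart_weight u.
Proof. by rewrite mulr_ge0// ?sqrtr_ge0// indicE ler0n. Qed.

Lemma indic_chart_weight E u : \1_E (chart_inv c u) * chart_weight u =
  \1_(c @` (E `&` chart_dom c)) u * volume_density x c u.
Proof.
rewrite /chart_weight mulrA; congr (_ * _).
by rewrite chart_imageE !indicE in_setI mulrC -natrM mulnb.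
Qed.

Lemma measurable_indic_chart_weight (E : set (borel S)) : measurable E ->
  measurable_fun setT (fun u : borel 'rV[R]_n =>
    \1_E (chart_inv c u) * chart_weight u).
Proof.
move=> mE; have mcE := measurable_chart_image c mE.
rewrite (_ : (fun u => _) =
  (volume_density x c \_ (c @` (E `&` chart_dom c)))); last first.
  apply/funext => u; rewrite indic_chart_weight patchE indicE.
  by case: ifPn => _; rewrite ?mul1r ?mul0r.
apply/(measurable_restrict _ mcE measurableT); rewrite setTI.
have mcod : measurable_fun (chart_cod c : set (borel 'rV[R]_n))
    (volume_density x c).
  apply: continuous_at_measurable; first exact: chart_cod_openE.
  by move=> u cu; apply: C1at_continuous; exact: C1at_chart_density.
apply: measurable_funS mcod; first exact: measurable_chart_cod.
by move=> _ [p [_ cp] <-]; exact: chart_codP.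
Qed.

Lemma ge0_integral_chart (h : borel S -> \bar R) :
  measurable_fun setT h -> (forall p, 0 <= h p)%E ->
  (\int[vol]_(p in chart_dom c) h p =
   \int[mu]_u (h (chart_inv c u) * (chart_weight u)%:E))%E.
Proof.
apply: ge0_integral_density.
- exact: measurable_chart_dom.
- exact: chart_weight_ge0.
- exact: measurable_indic_chart_weight.
move=> E mE; rewrite (vol_g Ac) ?subIsetr//; last first.
  by apply: measurableI => //; exact: measurable_chart_dom.
have [intE _ _] := mu_lebesgue; rewrite -intE.
- by apply: eq_integral => u _; rewrite indic_chart_weight.
- by move=> u; rewrite lee_fin mulr_ge0 ?sqrtr_ge0// indicE ler0n.
- apply/measurable_EFinP; have := measurable_indic_chart_weight mE.
  by congr (measurable_fun _ _); apply/funext => u; rewrite indic_chart_weight.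
Qed.

End Volume.
End ChartGeometry.

(** * The derivative along x^T *)

Section RadialDerivative.
Context {R : realType} {n : nat} {S : ptopologicalType}.
Variables (A : set (chart R n S)) (x : S -> 'rV[R]_n.+1).
Hypothesis immersion_x : smooth_immersion A x.
Hypothesis atlas_A : smooth_atlas A.
Implicit Types (c d : chart R n S) (f g : S -> R).

Definition C1_manifold f :=
  forall c u, A c -> chart_cod c u -> C1at (f \o chart_inv c) u.

(* The derivative of [f] in the direction x^T. *)
Definition chart_radial f c u :=
  \sum_i tangent_coef x c i u * pd i (f \o chart_inv c) u.

(** The transformation rule of the inverse metric under a change of coordinates with Jacobian matrix
    [M]. *)
Lemma gram_congr_inv (M G : 'M[R]_n) : M *m G *m M^T \in unitmx ->
  M^T *m invmx (M *m G *m M^T) *m M = invmx G.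
Proof.
move=> U; have := U; rewrite !unitmx_mul unitmx_tr => /andP[/andP[Mu Gu] _].
set Q := _ *m M.
have QG : Q *m G = 1%:M.
  apply: (can_inj (mulmxK (_ : M^T \in unitmx))); first by rewrite unitmx_tr.
  by rewrite mul1mx /Q -!mulmxA [M *m (G *m M^T)]mulmxA mulVmx// mulmx1.
by rewrite -[LHS](mulmxK Gu) QG mul1mx.
Qed.

(** With [M] the Jacobian of the transition, frames and coordinate derivatives are multiplied by
    [M], while the coefficients of x^T transform the opposite way, so [M] cancels in the sum. *)
Lemma chart_radial_indep f c d p : C1_manifold f -> A c -> A d ->
  chart_dom c p -> chart_dom d p ->
  chart_radial f c (c p) = chart_radial f d (d p).
Proof.
move=> cf Ac Ad cp dp.
have [_ /(_ c d Ac Ad)/(_ 1%N)[dT _]] := atlas_A.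
set T := transition c d in dT.
have TE : T (c p) = d p by rewrite /T /transition /= chart_mapK.
have dTp : differentiable T (c p) by apply: dT; exists p.
have near_d : \forall w \near c p, chart_inv d (T w) = chart_inv c w.
  apply: filterS (near_chart_overlap cp dp) => _ [q [cq dq] <-].
  by rewrite /T /transition /= !chart_mapK.
pose M := \matrix_(i, j) partial i T (c p) 0 j.
have pdE (F : S -> R) i : differentiable (F \o chart_inv d) (d p) ->
    pd i (F \o chart_inv c) (c p) = \sum_j M i j * pd j (F \o chart_inv d) (d p).
  move=> dF; have : \forall w \near c p,
      (F \o chart_inv c) w = (F \o chart_inv d) (T w).
    by apply: filterS near_d => w; rewrite /= => ->.
  move/near_eq_pd => ->; rewrite pd_comp//; last by rewrite TE.
  by rewrite TE; apply: eq_bigr => j _; rewrite mxE.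
set Jc := tangent_frame x c (c p); set Jd := tangent_frame x d (d p).
have JE : Jc = M *m Jd.
  apply/matrixP => i k; rewrite [RHS]mxE.
  transitivity (pd i (fun w => param x c w 0 k) (c p)).
    exact: (tangent_frameE immersion_x Ac i k (chart_codP cp)).
  rewrite [LHS](pdE (fun q => x q 0 k)); last first.
    apply: C1at_diff.
    exact: (C1at_param_coord immersion_x Ad k (chart_codP dp)).
  apply: eq_bigr => j _; congr (_ * _); apply/esym.
  exact: (tangent_frameE immersion_x Ad j k (chart_codP dp)).
have mE : metric x c (c p) = M *m metric x d (d p) *m M^T.
  by rewrite /metric -/Jc -/Jd JE trmx_mul !mulmxA.
have xE : param x c (c p) = param x d (d p) by rewrite /param /= !chart_mapK.
have aM j : \sum_i tangent_coef x c i (c p) * M i j = tangent_coef x d j (d p).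
  transitivity ((param x c (c p) *m Jc^T *m invmx (metric x c (c p)) *m M) 0 j).
    by rewrite [RHS]mxE; apply: eq_bigr => i _; rewrite tangent_coefE.
  rewrite tangent_coefE xE mE JE trmx_mul.
  (* Invertibility of the metric in [c] also yields that of [M], without recourse to the inverse
     transition. *)
  have U : M *m metric x d (d p) *m M^T \in unitmx.
    by rewrite -mE; apply: (metric_unitmx immersion_x Ac); exact: chart_codP.
  by rewrite -(gram_congr_inv U) !mulmxA.
rewrite /chart_radial.
under eq_bigr => i _.
  rewrite pdE; last by apply: C1at_diff; apply: cf => //; exact: chart_codP.
  rewrite mulr_sumr; over.
rewrite exchange_big; apply: eq_bigr => j _ /=.
by rewrite -aM mulr_suml; apply: eq_bigr => i _; rewrite mulrA.
Qed.

Variable cp : S -> chart R n S.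
Hypothesis cp_atlas : forall p, A (cp p) /\ chart_dom (cp p) p.

(** [cp] selects a chart around each point; for C^1 functions [radialE] shows that every chart of
    [A] gives the same value. *)
Definition radial f p := chart_radial f (cp p) (cp p p).

Lemma radialE f c u : C1_manifold f -> A c -> chart_cod c u ->
  radial f (chart_inv c u) = chart_radial f c u.
Proof.
move=> cf Ac cu; have [Acp domp] := cp_atlas (chart_inv c u).
have := chart_radial_indep cf Acp Ac domp (chart_inv_dom cu).
by rewrite chart_invK.
Qed.

Lemma chart_local_continuous (F : S -> R) :
  (forall c u, A c -> chart_cod c u -> {for u, continuous (F \o chart_inv c)}) ->
  continuous F.
Proof.
move=> cF p; have [Ac dc] := cp_atlas p; set c := cp p in Ac dc.
have : {for p, continuous ((F \o chart_inv c) \o chart_map c)}.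
  apply: continuous_comp; first exact: chart_map_continuous_at.
  by apply: cF => //; exact: chart_codP.
apply: near_eq_continuous.
by apply: filterS (near_chart_dom dc) => q cq /=; rewrite chart_mapK.
Qed.

Lemma C1_manifold_continuous f : C1_manifold f -> continuous f.
Proof.
by move=> cf; apply: chart_local_continuous => c u Ac cu; apply: C1at_continuous; exact: cf.
Qed.

Lemma radial_continuous f : C1_manifold f -> continuous (radial f).
Proof.
move=> cf; apply: chart_local_continuous => c u Ac cu.
apply: (@near_eq_continuous _ _ (chart_radial f c)).
  by apply: filterS (near_chart_cod cu) => w cw; rewrite /= radialE.
apply: continuous_at_sum => i.
apply: (@continuousM _ _ (tangent_coef x c i) (pd i (f \o chart_inv c))).
  by apply: C1at_continuous; exact: (C1at_tangent_coef immersion_x Ac).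
by have [_] := cf c u Ac cu; exact.
Qed.

Lemma C1_manifoldD f g : C1_manifold f -> C1_manifold g ->
  C1_manifold (fun p => f p + g p).
Proof. by move=> cf cg c u Ac cu; apply: C1atD; [exact: cf|exact: cg]. Qed.

Lemma C1_manifoldM f g : C1_manifold f -> C1_manifold g ->
  C1_manifold (fun p => f p * g p).
Proof. by move=> cf cg c u Ac cu; apply: C1atM; [exact: cf|exact: cg]. Qed.

Lemma C1_manifold_cst (k : R) : C1_manifold (fun=> k).
Proof. by move=> c u Ac cu; exact: C1at_cst. Qed.

Lemma radialD f g p : C1_manifold f -> C1_manifold g ->
  radial (fun q => f q + g q) p = radial f p + radial g p.
Proof.
have [Ac dc] := cp_atlas p => cf cg; rewrite /radial /chart_radial -big_split.
apply: eq_bigr => i _ /=; rewrite -mulrDr; congr (_ * _).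
apply: (@pdD _ _ _ (f \o chart_inv (cp p)) (g \o chart_inv (cp p))); apply: C1at_diff.
  by apply: cf => //; exact: chart_codP.
by apply: cg => //; exact: chart_codP.
Qed.

Lemma radial_near0 f p : (\forall q \near p, f q = 0) -> radial f p = 0.
Proof.
have [Ac dc] := cp_atlas p => f0; rewrite /radial /chart_radial big1// => i _.
rewrite (@near_eq_pd _ _ _ _ (cst 0)) ?pd_cst ?mulr0//.
apply: (near_chart_inv (P := fun q => f q = 0) (chart_codP dc)).
by rewrite chart_mapK.
Qed.

End RadialDerivative.

(** * Cutoff functions *)

Section SquaredPositivePart.
Context {R : realType}.

Definition pos2 (t : R) : R := Num.max 0 t ^+ 2.

Lemma pos2_eq0 t : t <= 0 -> pos2 t = 0.
Proof. by move=> t0; rewrite /pos2 max_l// expr0n. Qed.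

Lemma pos2_sqr t : 0 <= t -> pos2 t = t ^+ 2.
Proof. by move=> t0; rewrite /pos2 max_r. Qed.

(** A remainder bound uniform in [t] spares a separate treatment of the point 0. *)
Let pos2_taylor (t h : R) :
  `|pos2 (h + t) - pos2 t - 2 * Num.max 0 t * h| <= h ^+ 2.
Proof.
rewrite /pos2; case: (lerP 0 t) => t0; case: (lerP 0 (h + t)) => ht0;
  rewrite ler_norml; apply/andP; split; nra.
Qed.

Lemma is_derive_pos2 (t : R) : is_derive t 1 pos2 (2 * Num.max 0 t).
Proof.
pose a : R := 2 * Num.max 0 t.
have : is_diff t pos2 ( *:%R a : {linear R -> R}).
  apply: is_diff_littleo; first exact: scaler_continuous.
  move=> e e0; have : \forall h \near (0 : R), `|h| < e by exact: nbhs0_lt.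
  apply: filterS => h he; apply: le_trans (pos2_taylor t h) _.
  by rewrite -real_normK ?num_real// expr2 ler_wpM2r// ltW.
move=> [dp ep]; apply: DeriveDef; first exact/derivable1_diffP.
by rewrite deriveE// ep /= /a [_ *: _]mulr1.
Qed.

Lemma max0_continuous : continuous (fun t : R => 2 * Num.max 0 t).
Proof.
move=> t; apply: (@continuousM R R (fun=> 2) (Num.max 0)).
  exact: cst_continuous.
by apply: (@continuous_max R R (fun=> 0) id); [exact: cst_continuous|exact: cvg_id].
Qed.

Lemma C1at_pos2 n (f : 'rV[R]_n -> R) u : C1at f u -> C1at (fun w => pos2 (f w)) u.
Proof.
move=> cf; apply: (@C1at_comp1 _ _ pos2 (fun t => 2 * Num.max 0 t)) => //.
  by near=> t; exact: is_derive_pos2.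
exact: max0_continuous.
Unshelve. all: by end_near. Qed.

Lemma rV_bump n (u0 : 'rV[R]_n) (r : R) : 0 < r ->
  exists b : 'rV[R]_n -> R, [/\ forall u, C1at b u,
    \forall u \near u0, b u = 1 & forall u, r < `|u - u0| -> b u = 0].
Proof.
move=> r0; pose N (u : 'rV[R]_n) : R := \sum_i (u 0 i - u0 0 i) ^+ 2.
(* Where N < r^2 / 4 the inner [pos2] is at least 9/16 > 1/2, so the outer one vanishes; where N >=
   r^2 the inner one vanishes and the outer one is 1. Being identically 1 near [u0] is what the
   covering argument uses. *)
exists (fun u => 1 - pos2 (1 - 2 * pos2 (1 - N u / r ^+ 2))).
have cB (g : 'rV[R]_n -> R) u (k : R) : C1at g u -> C1at (fun w => k - g w) u.
  by move=> cg; apply: C1atD (C1at_cst k u) (C1atN cg).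
have cN u : C1at N u.
  apply: C1at_sum => i _.
  have ci : C1at (fun w : 'rV[R]_n => w 0 i - u0 0 i) u.
    by apply: C1atD (C1at_coord i u) (C1at_cst _ u).
  exact: (C1atM ci ci).
split.
- move=> u; apply: (cB); apply: C1at_pos2; apply: (cB).
  apply: (C1atM (C1at_cst _ u)); apply: C1at_pos2; apply: (cB).
  exact: C1atM (cN u) (C1at_cst _ u).
- have N0 : N u0 = 0 by rewrite /N big1// => i _; rewrite subrr expr0n.
  have r4 : 0 < r ^+ 2 / 4 by rewrite divr_gt0// exprn_gt0.
  have : \forall u \near u0, N u < r ^+ 2 / 4.
    have cN0 : N u @[u --> u0] --> N u0 by exact: (C1at_continuous (cN u0)).
    by apply: (cvgr_lt (N u0) cN0); rewrite N0.
  apply: filterS => u Nu.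
  have Nr : N u / r ^+ 2 < 4^-1 by rewrite ltr_pdivrMr ?exprn_gt0// mulrC.
  move: Nr; move: (_ / _) => q Nr.
  have q1 : 3 / 4 <= 1 - q by lra.
  move: q1; move: (1 - q) => y q1.
  rewrite (@pos2_sqr y); last lra.
  have y2 : 3 / 4 * (3 / 4) <= y ^+ 2 by rewrite expr2 ler_pM//; lra.
  by rewrite pos2_eq0 ?subr0//; lra.
(* [N] is a squared Euclidean norm, which dominates the square of the sup norm of u - u0. *)
- move=> u ru; have Nr : r ^+ 2 <= N u.
    rewrite leNgt; apply/negP => Nr; move: ru; rewrite ltNge => /negP; apply.
    rewrite [leLHS]/Num.Def.normr/= mx_normrE; apply/bigmax_leP; split=> [|[a i] _].
      exact: ltW.
    rewrite /= ord1 -(ger0_norm (ltW r0)) -ler_sqr ?nnegrE// !real_normK ?num_real//.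
    rewrite (le_trans _ (ltW Nr))// /N (bigD1 i)//= !mxE lerDl.
    by apply: sumr_ge0 => j _; exact: sqr_ge0.
  rewrite (@pos2_eq0 (1 - _ / _)).
    by rewrite mulr0 subr0 pos2_sqr// expr1n subrr.
  by rewrite subr_le0 ler_pdivlMr ?exprn_gt0// mul1r.
Qed.

End SquaredPositivePart.

(** * The divergence theorem for the tangential position field *)

Section DivergenceTheorem.
Context {R : realType} {n : nat} {S : ptopologicalType}.
Variables (A : set (chart R n S)) (x : S -> 'rV[R]_n.+1).
Variable vol : {measure set (borel S) -> \bar R}.
Hypothesis immersion_x : smooth_immersion A x.
Hypothesis hausdorff_S : hausdorff_space S.
Hypothesis atlas_A : smooth_atlas A.
Hypothesis minimal_x : minimal A x.
Hypothesis vol_g : volume_measure A x vol.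
Variable cp : S -> chart R n S.
Hypothesis cp_atlas : forall p, A (cp p) /\ chart_dom (cp p) p.
Variable mu : {measure set (borel 'rV[R]_n) -> \bar R}.
Hypothesis mu_lebesgue : lebesgue_rV_spec mu.

Notation radial := (radial x cp).

Lemma compact_norm_le m (Q : set 'rV[R]_m) : compact Q ->
  exists M : R, forall u, Q u -> `|u| <= M.
Proof.
move=> /compact_bounded[M [_ QM]]; exists (M + 1) => u Qu.
by apply: QM Qu; rewrite ltrDl.
Qed.

Lemma compact_continuous_bounded (T : topologicalType) (K : set T) (f : T -> R) :
  compact K -> {in K, continuous f} -> exists M : R, forall p, K p -> `|f p| <= M.
Proof.
move=> cK cf.
have /compact_bounded[M [_ KM]] : compact (f @` K).
  by apply: continuous_compact => //; exact: continuous_in_subspaceT.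
exists (M + 1) => p Kp; apply: (KM (M + 1)); first by rewrite ltrDl.
by exists p.
Qed.

Lemma measurable_compact (K : set (borel S)) : @compact S K -> measurable K.
Proof. by move=> cK; apply: borel_closed; exact: compact_closed. Qed.

Lemma vol_chart_compact_lty c Q : A c -> compact Q -> Q `<=` chart_cod c ->
  (vol (chart_inv c @` Q) < +oo)%E.
Proof.
move=> Ac cQ Qc; set E := chart_inv c @` Q.
have mE : measurable (E : set (borel S)).
  by apply: measurable_compact; exact: chart_compact_image.
have Edom : E `<=` chart_dom c.
  by move=> _ [u Qu <-]; apply: chart_inv_dom; exact: Qc.
have [M QM] := compact_norm_le cQ.
have [K QK] : exists K : R, forall u, Q u -> `|volume_density x c u| <= K.
  apply: compact_continuous_bounded cQ _ => u; rewrite inE => Qu.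
  apply: C1at_continuous; apply: (C1at_chart_density immersion_x Ac).
  exact: Qc.
have mQ : measurable (Q : set (borel 'rV[R]_n)).
  by apply: borel_closed; apply: compact_closed => //; exact: norm_hausdorff.
have [_ mu_fin _] := mu_lebesgue.
have muQ : (mu Q < +oo)%E.
  apply: le_lt_trans (mu_fin M); apply: le_measure; rewrite ?inE//.
  exact: measurable_norm_le.
have : (\int[vol]_(p in chart_dom c) (\1_E p)%:E < +oo)%E.
  rewrite (ge0_integral_chart immersion_x vol_g mu_lebesgue Ac).
  - apply: integrable_lty => //.
    have := @bounded_support_integrable R _ _ mu Q K
      (fun u => \1_E (chart_inv c u) * chart_weight x c u) mQ muQ
      (measurable_indic_chart_weight immersion_x Ac mE); apply.
    + move=> u Qu; rewrite /chart_weight !indicE.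
      rewrite [_ \in E]mem_set; last by exists u.
      by rewrite [_ \in chart_cod c]mem_set ?mul1r//; [exact: QK|exact: Qc].
    + move=> u Qu; rewrite /chart_weight !indicE.
      case: (boolP (u \in chart_cod c)) => [|_]; last by rewrite mul0r mulr0.
      rewrite inE => cu; rewrite [_ \in E]memNset ?mul0r// => -[w Qw wu].
      by apply: Qu; rewrite -(chart_invK cu) -wu chart_invK//; exact: Qc.
  - by apply/measurable_EFinP; exact: measurable_indic.
  - by move=> p; rewrite lee_fin.
rewrite integral_indic//; last exact: measurable_chart_dom.
by rewrite (setIidl Edom).
Qed.

Lemma continuous_compact_integrable_vol K (h : S -> R) : compact K ->
  (vol K < +oo)%E -> continuous h -> (forall p, ~ K p -> h p = 0) ->
  vol.-integrable setT (EFin \o h).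
Proof.
move=> cK volK ch h0.
have [M KM] : exists M : R, forall p, K p -> `|h p| <= M.
  by apply: compact_continuous_bounded cK _ => p _; exact: ch.
apply: (@bounded_support_integrable R _ _ vol K M h) => //.
  exact: measurable_compact.
by apply: continuous_at_measurable; [exact: openT|move=> p _; exact: ch].
Qed.

(** This is div (f x^T), as div x^T = n on a minimal hypersurface. *)
Let div_field f p := n%:R * f p + radial f p.

Lemma div_field_continuous f : C1_manifold A f -> continuous (div_field f).
Proof.
move=> cf p; apply: (@continuousD _ _ _ (fun q => n%:R * f q) (radial f)).
  apply: (@continuousM _ _ (fun=> n%:R) f); first exact: cst_continuous.
  exact: (C1_manifold_continuous cp_atlas cf).
exact: (radial_continuous immersion_x atlas_A cp_atlas cf).
Qed.

Lemma div_field_support K f : closed K -> (forall p, ~ K p -> f p = 0) ->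
  forall p, ~ K p -> div_field f p = 0.
Proof.
move=> cK f0 p Kp; rewrite /div_field f0// mulr0 add0r.
apply: (radial_near0 _ cp_atlas).
have : nbhs p (~` K) by apply: open_nbhs_nbhs; split=> //; exact: closed_openC.
by apply: filterS => q; exact: f0.
Qed.

Lemma maxe0M (y w : R) : 0 <= w -> maxe (y * w)%:E 0%E = (maxe y%:E 0 * w%:E)%E.
Proof.
move=> w0; have [y0|/ltW y0] := leP 0 y.
  by rewrite !max_l ?lee_fin ?mulr_ge0// EFinM.
by rewrite !max_r ?lee_fin ?mulr_le0_ge0// mul0e.
Qed.

Lemma divergence_local f c Q : C1_manifold A f -> A c -> compact Q ->
  Q `<=` chart_cod c -> (forall p, ~ (chart_inv c @` Q) p -> f p = 0) ->
  (\int[vol]_p (div_field f p)%:E = 0)%E.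
Proof.
move=> cf Ac cQ Qc f0; set K := chart_inv c @` Q in f0.
have cK : compact K by exact: chart_compact_image.
have volK : (vol K < +oo)%E by exact: vol_chart_compact_lty.
have H0 := div_field_support (compact_closed hausdorff_S cK) f0.
have Kdom : K `<=` chart_dom c.
  by move=> _ [u Qu <-]; apply: chart_inv_dom; exact: Qc.
have KQ u : chart_cod c u -> K (chart_inv c u) -> Q u.
  move=> cu [w Qw wu]; rewrite -(chart_invK cu) -wu chart_invK//.
  exact: Qc.
have mH : measurable_fun setT (div_field f : borel S -> R).
  apply: continuous_at_measurable; first exact: openT.
  by move=> p _; exact: div_field_continuous.
have clQ : closed Q by apply: compact_closed => //; exact: norm_hausdorff.
have [M QM] := compact_norm_le cQ.
(* The coordinates of f x^T times the density, extended by zero. The extension is C^1 on all of R^n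
   because [f] vanishes off [Q], which is closed in R^n and lies inside the open chart codomain. *)
pose F i u : R := if u \in chart_cod c then
  f (chart_inv c u) * (volume_density x c u * tangent_coef x c i u) else 0.
have nearF i u : chart_cod c u -> \forall w \near u,
    f (chart_inv c w) * (volume_density x c w * tangent_coef x c i w) = F i w.
  by move=> /near_chart_cod; apply: filterS => w cw; rewrite /F mem_set.
have nearF0 i u : ~ chart_cod c u -> \forall w \near u, 0 = F i w.
  move=> cu; have : nbhs u (~` Q).
    by apply: open_nbhs_nbhs; split; [exact: closed_openC|move=> /Qc].
  apply: filterS => w Qw; rewrite /F; case: ifPn => //; rewrite inE => cw.
  by rewrite f0 ?mul0r// => /(KQ _ cw).
have cF i u : C1at (F i) u.
  have [cu|cu] := pselect (chart_cod c u).
    apply: near_eq_C1at (nearF i u cu) _.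
    apply: C1atM; first exact: cf.
    apply: C1atM; first exact: (C1at_chart_density immersion_x Ac).
    exact: (C1at_tangent_coef immersion_x Ac).
  exact: near_eq_C1at (nearF0 i u cu) (C1at_cst 0 u).
have F0 i u : M < `|u| -> F i u = 0.
  move=> Mu; rewrite /F; case: ifPn => //; rewrite inE => cu.
  rewrite f0 ?mul0r// => /(KQ _ cu)/QM.
  by rewrite leNgt Mu.
have sumF u : \sum_i pd i (F i) u =
    div_field f (chart_inv c u) * chart_weight x c u.
  rewrite /chart_weight indicE; have [cu|cu] := pselect (chart_cod c u).
    rewrite mem_set// mul1r /div_field (radialE immersion_x atlas_A cp_atlas cf Ac cu).
    have E i : pd i (F i) u = (f \o chart_inv c) u *
        pd i (fun w => volume_density x c w * tangent_coef x c i w) u +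
        volume_density x c u * (tangent_coef x c i u * pd i (f \o chart_inv c) u).
      rewrite -(near_eq_pd i (nearF i u cu)).
      have cs := C1at_chart_density immersion_x Ac cu.
      have ca := C1at_tangent_coef immersion_x Ac i cu.
      rewrite (pdM i (C1at_diff (cf c u Ac cu)) (C1at_diff (C1atM cs ca))).
      by rewrite addrC; congr (_ + _); rewrite mulrC -mulrA.
    under eq_bigr do rewrite E.
    rewrite big_split /= -!mulr_sumr (divergence_chart immersion_x Ac minimal_x cu).
    rewrite -/(chart_radial x f c u); move: (chart_radial _ _ _ _) => a /=.
    by move: (volume_density _ _ _) (f _) => s b; ring.
  rewrite memNset// mul0r mulr0 big1// => i _.
  by rewrite -(near_eq_pd i (nearF0 i u cu)) pd_cst.
have [_ mu_fin mu_div] := mu_lebesgue.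
have ipd i : mu.-integrable setT (EFin \o pd i (F i)).
  have pd0 := support_pd0 i (F0 i).
  have [B FB] := continuous_compact_support_bounded (fun u => (cF i u).2 i) pd0.
  apply: (@bounded_support_integrable R _ _ mu [set v | `|v| <= M] B) => //.
  - exact: measurable_norm_le.
  - apply: continuous_at_measurable; first exact: openT.
    by move=> u _; exact: (cF i u).2.
  - by move=> u /= /negP; rewrite -ltNge; exact: pd0.
(* The change of variables is available for nonnegative functions; [g] stands for the positive or
   the negative part, both of which commute with a nonnegative weight. *)
have part (g : \bar R -> \bar R) : measurable_fun setT g -> g 0%E = 0%E ->
    (forall y, 0 <= g y)%E ->
    (forall y w : R, 0 <= w -> g (y * w)%:E = (g y%:E * w%:E)%E) ->
    (\int[vol]_p g (div_field f p)%:E =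
     \int[mu]_u g (\sum_i pd i (F i) u)%R%:E)%E.
  move=> mg g0 gge0 gM.
  transitivity (\int[vol]_(p in chart_dom c) g (div_field f p)%:E)%E.
    rewrite [RHS]integral_mkcond; apply: eq_integral => p _; rewrite patchE.
    case: ifPn => //; rewrite notin_setE => dp; rewrite H0// => /Kdom.
    exact: dp.
  rewrite (ge0_integral_chart immersion_x vol_g mu_lebesgue Ac).
  - apply: eq_integral => u _; rewrite sumF gM//.
    exact: chart_weight_ge0.
  - by apply: measurableT_comp => //; exact/measurable_EFinP.
  - by move=> p; exact: gge0.
have -> : (\int[vol]_p (div_field f p)%:E =
    \int[mu]_u (\sum_i pd i (F i) u)%R%:E)%E.
  rewrite integralE [RHS]integralE; congr (_ - _)%E; rewrite unlock.
    apply: (part (fun y => maxe y 0%E)).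
    + by apply: measurable_maxe.
    + by rewrite maxxx.
    + by move=> y; rewrite le_max lexx orbT.
    + exact: maxe0M.
  apply: (part (fun y => maxe (- y) 0%E)%E).
  + by apply: measurable_maxe => //; exact: measurable_oppe.
  + by rewrite oppe0 maxxx.
  + by move=> y; rewrite le_max lexx orbT.
  + by move=> y w w0; rewrite -!EFinN -mulNr; exact: maxe0M.
under eq_integral do rewrite -sumEFin.
rewrite integral_sum//.
by rewrite big1// => i _; apply: mu_div (F0 i).
Qed.

End DivergenceTheorem.

(** * From one chart to the whole hypersurface *)

Section GlobalDivergence.
Context {R : realType} {n : nat} {S : ptopologicalType}.
Variables (A : set (chart R n S)) (x : S -> 'rV[R]_n.+1).
Variable vol : {measure set (borel S) -> \bar R}.
Hypothesis immersion_x : smooth_immersion A x.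
Hypothesis hausdorff_S : hausdorff_space S.
Hypothesis atlas_A : smooth_atlas A.
Hypothesis minimal_x : minimal A x.
Hypothesis vol_g : volume_measure A x vol.
Variable cp : S -> chart R n S.
Hypothesis cp_atlas : forall p, A (cp p) /\ chart_dom (cp p) p.
Variable mu : {measure set (borel 'rV[R]_n) -> \bar R}.
Hypothesis mu_lebesgue : lebesgue_rV_spec mu.

Notation radial := (radial x cp).

Lemma compact_norm_ball m (u0 : 'rV[R]_m) (r : R) :
  compact [set u : 'rV[R]_m | `|u - u0| <= r].
Proof.
apply: bounded_closed_compact.
  exists (r + `|u0|); split; first exact: num_real.
  move=> K rK u /= ur; apply: le_trans (ltW rK).
  by rewrite -[u](subrK u0); apply: le_trans (ler_normD _ _) _; rewrite lerD2r.
apply: (@preimage_closed _ _ (fun u : 'rV[R]_m => `|u - u0|) [set t | t <= r]).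
  move=> u _; apply: (@continuous_comp _ _ _ (fun u : 'rV[R]_m => u - u0)).
    by apply: continuousB; [exact: cvg_id|exact: cst_continuous].
  exact: norm_continuous.
exact: closed_le.
Qed.

Lemma manifold_bump (p : S) : exists c Q (chi : S -> R),
  [/\ A c, compact Q /\ Q `<=` chart_cod c, C1_manifold A chi,
      \forall q \near p, chi q = 1 &
      forall q, ~ (chart_inv c @` Q) q -> chi q = 0].
Proof.
have [Ac dc] := cp_atlas p; set c := cp p in Ac dc; set u0 := c p.
have /nbhs_ballP[e /= e0 eV] : nbhs u0 (chart_cod c).
  exact: near_chart_cod (chart_codP dc).
pose r := e / 2; have r0 : 0 < r by rewrite divr_gt0.
have re : r < e by rewrite /r ltr_pdivrMr// ltr_pMr// ltr1n.
have [b [bC1 b1 b0]] := rV_bump u0 r0.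
pose Q := [set u : 'rV[R]_n | `|u - u0| <= r].
have cQ : compact Q by exact: compact_norm_ball.
have Qc : Q `<=` chart_cod c.
  move=> u Qu; apply: eV; rewrite -ball_normE /ball_ /= distrC.
  exact: le_lt_trans Qu re.
pose chi q : R := if q \in chart_dom c then b (c q) else 0.
have chi0 q : ~ (chart_inv c @` Q) q -> chi q = 0.
  move=> KQ; rewrite /chi; case: ifPn => //; rewrite inE => dq.
  apply: b0; rewrite ltNge; apply/negP => Qq; apply: KQ.
  by exists (c q) => //; rewrite chart_mapK.
exists c, Q, chi; split => //.
  move=> d v Ad dv.
  (* Outside the domain of [c], [chi] vanishes near the point: the image of [Q] is compact, hence
     closed in the Hausdorff space [S]. Inside it, the transition map carries the regularity of [b]
     over to [d]. *)
  have [cv|cv] := pselect (chart_dom c (chart_inv d v)); last first.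
    apply: near_eq_C1at (C1at_cst 0 v).
    apply: (near_chart_inv (P := fun q => 0 = chi q) dv).
    have : nbhs (chart_inv d v) (~` (chart_inv c @` Q)).
      apply: open_nbhs_nbhs; split.
        apply: closed_openC; apply: compact_closed => //.
        exact: chart_compact_image.
      by move=> [w Qw wv]; apply: cv; rewrite -wv; apply: chart_inv_dom; exact: Qc.
    by apply: filterS => q /chi0.
  have [_ /(_ d c Ad Ac)/(_ 1%N)[dT cT]] := atlas_A.
  set T := transition d c in dT cT.
  have overlap : \forall w \near v, (d @` (chart_dom d `&` chart_dom c)) w.
    rewrite -(chart_invK dv); apply: near_chart_overlap => //.
    exact: chart_inv_dom.
  have : C1at (fun w => b (T w)) v.
    apply: C1at_comp; first exact: bC1.
      by apply: filterS overlap => w; exact: dT.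
    by move=> i; apply: cT; exact: nbhs_singleton overlap.
  apply: near_eq_C1at; apply: filterS overlap => _ [q [dq cq] <-].
  by rewrite /T /transition /chi /= chart_mapK// mem_set.
have : \forall q \near p, b (c q) = 1 by move: b1 => /(chart_map_continuous_at dc).
have := near_chart_dom dc.
by apply: filterS2 => q dq <-; rewrite /chi mem_set.
Qed.

Lemma compact_seq_cover (K : set S) (P : S -> S -> Prop) : compact K ->
  (forall p, \forall q \near p, P p q) ->
  exists l : seq S, forall q, K q -> exists2 p, p \in l & P p q.
Proof.
move=> cK nP; move: cK; rewrite compact_cover => cK.
have [] := cK S setT (fun p => (P p)°).
- by move=> p _; exact: open_interior.
- by move=> q Kq; exists q => //; exact: nP.
move=> D _ KD; exists (finmap.enum_fset D) => q /KD[p /= pD]; move/interior_subset => Pq.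
by exists p.
Qed.

(** A compact set is covered by finitely many images of compact subsets of chart codomains, and on
    each of these the density is bounded. *)
Lemma vol_compact_lty (K : set S) : compact K -> (vol K < +oo)%E.
Proof.
have /choice[bc /choice[bQ /choice[chi chiP]]] := manifold_bump.
move=> cK; have [|l lK] := @compact_seq_cover K (fun p q => chi p q = 1) cK.
  by move=> p; have [] := chiP p.
pose E p : set (borel S) := chart_inv (bc p) @` bQ p.
have mE p : measurable (E p).
  apply: measurable_compact => //; have [_ [cQ Qc] _ _ _] := chiP p.
  exact: chart_compact_image.
have mK : measurable (K : set (borel S)) by exact: measurable_compact.
have KE : K `<=` \big[setU/set0]_(p <- l) E p.
  move=> q /lK[p pl chi1]; rewrite -bigcup_seq; exists p => //.
  apply: contrapT => Eq; have [_ _ _ _ /(_ q Eq)] := chiP p.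
  by rewrite chi1 => /eqP; rewrite oner_eq0.
apply: (@le_lt_trans _ _ (vol (\big[setU/set0]_(p <- l) E p))).
  apply: le_measure => //; rewrite inE//.
  by apply: bigsetU_measurable => p _; exact: mE.
elim: (l) => [|p s IH]; first by rewrite big_nil measure0.
rewrite big_cons; apply: le_lt_trans (measureU2 _ _ _) _ => //.
  by apply: bigsetU_measurable => q _; exact: mE.
apply: lte_add_pinfty => //; have [Ac [cQ Qc] _ _ _] := chiP p.
exact: (vol_chart_compact_lty immersion_x hausdorff_S vol_g mu_lebesgue).
Qed.

Lemma div_field_integrable K f : C1_manifold A f -> compact K ->
  (forall p, ~ K p -> f p = 0) ->
  vol.-integrable setT (EFin \o (fun p => n%:R * f p + radial f p)).
Proof.
move=> cf cK f0; apply: (continuous_compact_integrable_vol hausdorff_S cK).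
- exact: vol_compact_lty.
- exact: (div_field_continuous immersion_x atlas_A cp_atlas cf).
- exact: (div_field_support x cp_atlas (compact_closed hausdorff_S cK) f0).
Qed.

Lemma divergence_theorem K f : C1_manifold A f -> compact K ->
  (forall p, ~ K p -> f p = 0) ->
  (\int[vol]_p (n%:R * f p + radial f p)%:E = 0)%E.
Proof.
have /choice[bc /choice[bQ /choice[chi chiP]]] := manifold_bump.
move=> cf cK f0; have [|l lK] := @compact_seq_cover K (fun p q => chi p q = 1) cK.
  by move=> p; have [] := chiP p.
(* The invariant of the induction on the list of cutoffs. In f = f chi + f (1 - chi) the first part
   lives in one chart, and the second vanishes where chi = 1, so the remaining cutoffs serve it;
   they need not sum to 1. *)
have {lK} : forall q, f q != 0 -> exists2 p, p \in l & chi p q = 1.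
  move=> q fq; apply: lK; apply: contrapT => /f0 /eqP.
  by rewrite (negbTE fq).
elim: l f cf f0 => [|p l IH] f cf f0 lf.
  have fE : f = cst 0.
    apply/funext => q; apply/eqP; apply: contrapT => /negP /lf[].
    by [].
  apply: integral0_eq => q _; rewrite (radial_near0 _ cp_atlas).
    by rewrite fE mulr0 addr0.
  by near=> q'; rewrite fE.
have [Ac [cQ Qc] cchi _ chi0] := chiP p.
pose f1 q := f q * chi p q; pose f2 q := f q * (1 - chi p q).
have c1 : C1_manifold A f1 by exact: C1_manifoldM.
have c2 : C1_manifold A f2.
  apply: C1_manifoldM => //; have := C1_manifoldD (@C1_manifold_cst _ _ _ A 1)
    (C1_manifoldM (@C1_manifold_cst _ _ _ A (-1)) cchi).
  by congr C1_manifold; apply/funext => q; rewrite mulN1r.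
have f10 q : ~ K q -> f1 q = 0 by move=> Kq; rewrite /f1 f0 ?mul0r.
have f20 q : ~ K q -> f2 q = 0 by move=> Kq; rewrite /f2 f0 ?mul0r.
have E q : (n%:R * f q + radial f q)%:E =
    ((n%:R * f1 q + radial f1 q)%:E + (n%:R * f2 q + radial f2 q)%:E)%E.
  have fE : f = (fun q => f1 q + f2 q).
    by apply/funext => q'; rewrite /f1 /f2 -mulrDr addrC subrK mulr1.
  rewrite [in LHS]fE (radialD _ cp_atlas _ c1 c2) -EFinD; congr (_%:E); ring.
under eq_integral do rewrite E.
rewrite integralD//=; [|exact: div_field_integrable c1 cK f10|
  exact: div_field_integrable c2 cK f20].
rewrite (divergence_local immersion_x hausdorff_S atlas_A minimal_x vol_g
  cp_atlas mu_lebesgue c1 Ac cQ Qc); last first.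
  by move=> q /chi0; rewrite /f1 => ->; rewrite mulr0.
rewrite add0e; apply: IH => // q; rewrite /f2 mulf_eq0 negb_or => /andP[fq chi1].
have [p' + chi'] := lf q fq; rewrite inE => /orP[/eqP p'p|p'l]; last by exists p'.
by move: chi1; rewrite -p'p chi' subrr eqxx.
Unshelve. all: by end_near. Qed.

End GlobalDivergence.

(** * Volume growth *)

Section PositivePartPower.
Context {R : realType}.

Definition posX (k : nat) (t : R) : R := Num.max 0 t ^+ k.

Lemma posX_pos2 k t : posX k.+2 t = pos2 t * t ^+ k.
Proof.
rewrite /posX /pos2; have [t0|t0] := leP 0 t; first by rewrite -exprD.
by rewrite !expr0n /= mul0r.
Qed.

Lemma is_derive_posX k (t : R) :
  is_derive t 1 (posX k.+2) (k.+2%:R * posX k.+1 t).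
Proof.
have -> : posX k.+2 = pos2 * (fun t => t ^+ k).
  by apply/funext => s; rewrite posX_pos2.
have dX : is_derive t 1 (fun s : R => s ^+ k) (k%:R * t ^+ k.-1).
  apply: DeriveDef; first exact: exprn_derivable.
  by rewrite exp_derive [_%:A]mulr1.
apply: (is_derive_eq (is_deriveM (is_derive_pos2 t) dX)).
rewrite /posX /pos2; have [t0|t0] := leP 0 t; last first.
  by rewrite !expr0n /= scale0r !mulr0 scaler0 addr0.
(* For k = 0 the truncated exponent [k.-1] is harmless, its coefficient being zero. *)
rewrite /GRing.scale /=; case: k {dX} => [|k] /=.
  by rewrite mul0r mulr0 add0r expr0 mul1r expr1.
have -> : k.+3%:R = k.+1%:R + 2 :> R by rewrite -natrD addn2.
by rewrite !exprS; ring.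
Qed.

Lemma posX_continuous k : continuous (posX k).
Proof.
move=> t; apply: (@continuous_comp R R R (Num.max 0) (fun s : R => s ^+ k) t).
  by apply: (@continuous_max R R (fun=> 0) id); [exact: cst_continuous|exact: cvg_id].
exact: exprn_continuous.
Qed.

End PositivePartPower.

(** * From geometric to polynomial growth *)

Section GeometricIteration.
Context {R : realType}.

Lemma geometric_bracket (q t : R) : 1 < q -> 1 <= t ->
  exists k, t <= q ^+ k <= q * t.
Proof.
move=> q1 t1; have q0 : 0 < q by apply: lt_trans q1.
have ex : exists k, t <= q ^+ k.
  have q10 : 0 < q - 1 by rewrite subr_gt0.
  (* Bernoulli's inequality k (q - 1) <= q^k shows that this exponent is large enough. *)
  exists (Num.bound (t / (q - 1))); set k := Num.bound _.
  have tk : t / (q - 1) < k%:R.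
    by apply: archi_boundP; rewrite divr_ge0 ?(ltW q10)// (le_trans ler01).
  have : t < k%:R * (q - 1) by rewrite -ltr_pdivrMr.
  move=> /ltW/le_trans; apply.
  elim: {tk} k => [|k IH]; first by rewrite mul0r expr0.
  rewrite exprS; have qk : 1 <= q ^+ k by rewrite exprn_ege1// ltW.
  have -> : q * q ^+ k = q ^+ k + (q - 1) * q ^+ k by ring.
  by rewrite -natr1 mulrDl mul1r lerD// ler_peMr// ltW.
exists (ex_minn ex); case: ex_minnP => [[|k] tk kmin]; rewrite tk /=.
  by rewrite expr0 -[leLHS]mulr1 ler_pM// ltW.
rewrite exprS ler_pM2l//; apply/ltW; rewrite ltNge; apply/negP => /kmin.
by rewrite ltnn.
Qed.

Lemma polynomial_of_geometric (v : R -> R) (q L s0 : R) : 1 < q ->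
  {homo v : s t / s <= t} -> (forall s, 0 <= v s) -> 1 <= s0 ->
  (forall s, s0 <= s -> v (q * s) <= L * v s) ->
  exists d, forall t, 1 <= t -> v t <= q ^+ d * v s0 * t ^+ d.
Proof.
move=> q1 v_mono v_ge0 s01 vL; have q0 : 0 <= q by rewrite ltW// (lt_trans ltr01).
(* With L <= q^d, [k] steps cost a factor (q^k)^d; as q^k <= q t, this is at most (q t)^d. *)
have [d /andP[Ld _]] : exists k, Num.max 1 L <= q ^+ k <= q * Num.max 1 L.
  by apply: geometric_bracket => //; rewrite le_max lexx.
exists d => t t1; have [k /andP[tk kt]] := geometric_bracket q1 t1.
have iter j : v (q ^+ j * s0) <= (q ^+ d) ^+ j * v s0.
  elim: j => [|j IH]; first by rewrite !expr0 !mul1r.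
  rewrite 2!exprS -!mulrA; apply: le_trans (vL _ _) _.
    by rewrite ler_peMl ?exprn_ege1 ?ltW// (lt_le_trans _ s01).
  apply: (@le_trans _ _ (q ^+ d * v (q ^+ j * s0))).
    by rewrite ler_wpM2r// (le_trans _ Ld)// le_max lexx orbT.
  by rewrite ler_wpM2l// exprn_ge0.
apply: le_trans (v_mono _ (q ^+ k * s0) _) _.
  by apply: le_trans tk _; rewrite ler_peMr// exprn_ge0.
apply: le_trans (iter k) _; rewrite -exprM mulnC exprM.
rewrite mulrAC ler_wpM2r// -exprMn.
by apply: lerXn2r; rewrite ?nnegrE ?exprn_ge0 ?mulr_ge0// (le_trans ler01).
Qed.

End GeometricIteration.

Section VolumeGrowth.
Context {R : realType} {n : nat} {S : ptopologicalType}.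
Variables (A : set (chart R n S)) (x : S -> 'rV[R]_n.+1).
Variable vol : {measure set (borel S) -> \bar R}.
Hypothesis immersion_x : smooth_immersion A x.
Hypothesis hausdorff_S : hausdorff_space S.
Hypothesis atlas_A : smooth_atlas A.
Hypothesis minimal_x : minimal A x.
Hypothesis proper_x : proper_map x.
Hypothesis vol_g : volume_measure A x vol.
Variable cp : S -> chart R n S.
Hypothesis cp_atlas : forall p, A (cp p) /\ chart_dom (cp p) p.
Variable mu : {measure set (borel 'rV[R]_n) -> \bar R}.
Hypothesis mu_lebesgue : lebesgue_rV_spec mu.
Variable beta : R.
Hypothesis perp_le : forall p,
  dotp (x_perp x (cp p) p) (x_perp x (cp p) p) <= beta.

Notation radial := (radial x cp).

Let N p := dotp (x p) (x p).
(** Equal to |x^T|^2, since x^T is the orthogonal projection of x. *)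
Let T p := dotp (x p) (tangent_proj x (cp p) (cp p p) (x p)).

Let param_cp p : param x (cp p) (cp p p) = x p.
Proof. by have [_ dp] := cp_atlas p; rewrite /param /= chart_mapK. Qed.

Let T_ge0 p : 0 <= T p.
Proof.
have [Ap dp] := cp_atlas p; rewrite /T.
have [-> _] := dotp_tangent_proj immersion_x Ap (x p) (chart_codP dp).
exact: dotp_ge0.
Qed.

Let T_ge p : N p - beta <= T p.
Proof.
have [Ap dp] := cp_atlas p; rewrite /T.
have [_ ->] := dotp_tangent_proj immersion_x Ap (x p) (chart_codP dp).
by rewrite lerB// perp_le.
Qed.

Let beta_ge0 : 0 <= beta.
Proof. exact: le_trans (dotp_ge0 _) (perp_le point). Qed.

Let C1_N_chart c u : A c -> chart_cod c u -> C1at (N \o chart_inv c) u.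
Proof.
move=> Ac cu; apply: C1at_sum => k _.
by apply: C1atM; exact: (C1at_param_coord immersion_x Ac k cu).
Qed.

Section Composition.
Variables (g g' : R -> R).
Hypothesis dg : forall t : R, is_derive t 1 g (g' t).
Hypothesis cg' : continuous g'.

Lemma C1_manifold_normsq : C1_manifold A (fun p => g (N p)).
Proof.
move=> c u Ac cu; apply: (@C1at_comp1 _ _ g g' (N \o chart_inv c)).
- exact: C1_N_chart.
- by near=> t; exact: dg.
- exact: cg'.
Unshelve. all: by end_near. Qed.

(** The tangential gradient of |x|^2 is 2 x^T, so its derivative along x^T is 2 |x^T|^2. *)
Lemma radial_normsq p : radial (fun q => g (N q)) p = g' (N p) * (2 * T p).
Proof.
have [Ap dp] := cp_atlas p; have cu := chart_codP dp.
set c := cp p in Ap dp cu *; set u := c p in cu *.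
have cX k := C1at_param_coord immersion_x Ap k cu.
have XE : N (chart_inv c u) = N p by rewrite /u chart_mapK.
have pdN i : pd i (N \o chart_inv c) u =
    2 * \sum_k param x c u 0 k * tangent_frame x c u i k.
  rewrite [LHS]pd_sum; last by move=> k; exact: (C1atM (cX k) (cX k)).
  rewrite mulr_sumr; apply: eq_bigr => k _.
  rewrite (pdM i (C1at_diff (cX k)) (C1at_diff (cX k))).
  rewrite (tangent_frameE immersion_x Ap i k cu) mulrC -mulr2n.
  by rewrite -[LHS]mulr_natl.
rewrite /radial /chart_radial -/c -/u.
transitivity (g' (N p) * (2 * \sum_i tangent_coef x c i u *
    \sum_k param x c u 0 k * tangent_frame x c u i k)).
  rewrite !mulr_sumr; apply: eq_bigr => i _.
  have -> : pd i ((fun q => g (N q)) \o chart_inv c) u =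
      g' (N p) * pd i (N \o chart_inv c) u.
    rewrite -XE; apply: (@pd_comp1 _ _ i g g' (N \o chart_inv c) u _ (dg _)).
    by apply: C1at_diff; exact: C1_N_chart.
  by rewrite pdN; ring.
congr (_ * (_ * _)).
under eq_bigr do rewrite mulr_sumr.
rewrite exchange_big /T /dotp; apply: eq_bigr => k _ /=.
rewrite -/c -/u -[x p]param_cp -/c -/u -tangent_coef_proj mulr_sumr.
by apply: eq_bigr => i _; ring.
Qed.

End Composition.

(** The shift by [beta] ensures that |x^T|^2 > s outside [K s]. *)
Let K s := [set p | N p <= s + beta].

Lemma compact_normsq_le (m : nat) (r : R) :
  compact [set w : 'rV[R]_m | dotp w w <= r].
Proof.
apply: bounded_closed_compact.
  exists (1 + `|r|); split; first exact: num_real.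
  move=> M rM w /= wr; rewrite [leLHS]/Num.Def.normr/= mx_normrE.
  have M0 : 0 <= M by apply: le_trans (ltW rM); rewrite addr_ge0.
  apply/bigmax_leP; split=> // -[a i] _ /=; rewrite ord1.
  rewrite -(ger0_norm M0) -ler_sqr ?nnegrE// !real_normK ?num_real//.
  have wi : w 0 i ^+ 2 <= r.
    apply: le_trans wr; rewrite /dotp (bigD1 i)//= -expr2 lerDl.
    by apply: sumr_ge0 => j _; rewrite -expr2 sqr_ge0.
  apply: le_trans wi _; have r1 := ler_norm r; have r0 := normr_ge0 r.
  by move: (`|r|) r1 r0 rM => q r1 r0 rM; nra.
apply: (@preimage_closed _ _ (fun w : 'rV[R]_m => dotp w w) [set t | t <= r]).
  move=> w _; apply: C1at_continuous; apply: C1at_sum => k _.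
  exact: C1atM (C1at_coord k w) (C1at_coord k w).
exact: closed_le.
Qed.

Let compact_K s : compact (K s).
Proof.
have := proper_x (@compact_normsq_le n.+1 (s + beta)).
exact.
Qed.

Let measurable_K s : measurable (K s : set (borel S)).
Proof. exact: measurable_compact. Qed.

Let vol_K_lty s : (vol (K s) < +oo)%E.
Proof.
exact: (vol_compact_lty immersion_x hausdorff_S atlas_A vol_g cp_atlas mu_lebesgue).
Qed.

Let E s := K (3 / 2 * s) `\` K s.

(* The integrand n f + <grad f, x^T> for f = (2 s + beta - |x|^2)_+ ^ (n + 2). *)
Let h s p : R := n%:R * posX n.+2 (2 * s + beta - N p) +
  (- (n.+2%:R * posX n.+1 (2 * s + beta - N p))) * (2 * T p).

Let h_le s p : beta <= s -> 0 < s ->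
  h s p <= n%:R * (4 * s) ^+ n.+2 * \1_(K s) p - (s / 2) ^+ n.+2 * \1_(E s) p.
Proof.
move=> bs s0; rewrite /h; set y := 2 * s + beta - N p.
have hE : n%:R * posX n.+2 y + - (n.+2%:R * posX n.+1 y) * (2 * T p) =
    posX n.+1 y * (n%:R * Num.max 0 y - 2 * n.+2%:R * T p).
  by rewrite /posX exprS; ring.
have n0 : 0 <= n%:R :> R by exact: ler0n.
have n2 : n.+2%:R = n%:R + 2 :> R by rewrite -addn2 natrD.
have Y0 k : 0 <= posX k y by rewrite exprn_ge0// le_max lexx.
have Tp := T_ge0 p; have Tb := T_ge p.
rewrite !indicE; have [Ks|Ks] := pselect (K s p).
  rewrite mem_set// memNset ?mulr0 ?subr0 ?mulr1; last by case.
  apply: (@le_trans _ _ (n%:R * posX n.+2 y)).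
    rewrite gerDl mulNr oppr_le0 mulr_ge0 ?mulr_ge0//.
  (* On [K s], y <= 2 s + beta <= 3 s, because |x|^2 >= 0 and beta <= s. *)
  rewrite ler_wpM2l// /posX lerXn2r ?nnegrE ?le_max ?lexx//; first lra.
  rewrite ge_max; apply/andP; split; first lra.
  by rewrite /y; have := dotp_ge0 (x p); rewrite -/(N p); lra.
have {}Ks : s + beta < N p by rewrite ltNge; apply/negP.
rewrite (@memNset _ (K s)) ?mulr0 ?sub0r; last by rewrite /K /= leNgt Ks.
have Tn : 2 * n.+2%:R * s <= 2 * n.+2%:R * T p.
  by rewrite ler_wpM2l ?mulr_ge0//; lra.
have [Kt|Kt] := pselect (K (3 / 2 * s) p).
  rewrite mem_set ?mulr1; last by split=> //; rewrite /K /= leNgt Ks.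
  rewrite /K /= in Kt.
  have y1 : s / 2 <= y by rewrite /y; lra.
  have y2 : y <= s by rewrite /y; lra.
  have ymax : Num.max 0 y = y by rewrite max_r//; lra.
  rewrite hE ymax lerNr -mulrN.
  have -> : (s / 2) ^+ n.+2 = (s / 2) ^+ n.+1 * (s / 2) by rewrite exprSr.
  apply: ler_pM; [by rewrite exprn_ge0//; lra|lra| |].
    by rewrite /posX ymax lerXn2r// nnegrE; lra.
  (* The bracket is at most n s - 2 (n + 2) s = - (n + 4) s, which is below - s / 2. *)
  have ny : n%:R * y <= n%:R * s by rewrite ler_wpM2l.
  have ns : 0 <= n%:R * s by rewrite mulr_ge0// ltW.
  by rewrite n2 in Tn *; lra.
rewrite (@memNset _ (E s)) ?mulr0 ?oppr0; last by case.
have {}Kt : 3 / 2 * s + beta < N p by rewrite ltNge; apply/negP.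
rewrite hE mulr_ge0_le0// subr_le0; apply: le_trans Tn.
(* Beyond the annulus only the sign matters: the bracket is at most n s - 2 (n + 2) s. *)
have ym : Num.max 0 y <= s by rewrite ge_max; apply/andP; split; rewrite /y; lra.
apply: (@le_trans _ _ (n%:R * s)); first by rewrite ler_wpM2l.
by rewrite ler_wpM2r ?ltW// n2; lra.
Qed.

Let h_integral s : (\int[vol]_p (h s p)%:E = 0)%E /\
  vol.-integrable setT (EFin \o h s).
Proof.
pose g (t : R) := posX n.+2 (2 * s + beta - t).
pose g' (t : R) := - (n.+2%:R * posX n.+1 (2 * s + beta - t)).
have dg (t : R) : is_derive t 1 g (g' t).
  have d1 : is_derive t 1 (fun t => 2 * s + beta - t) (- 1).
    by apply: (is_derive_eq (is_deriveB (is_derive_cst _ _ _) (is_derive_id _ _))); rewrite sub0r.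
  have d2 := @is_derive1_comp R (posX n.+2) (fun t => 2 * s + beta - t) t _ _
    (is_derive_posX n (2 * s + beta - t)) d1.
  apply: (is_derive_eq d2).
  by rewrite /g' mulrN1.
have cg' : continuous g'.
  move=> t; apply: (@continuousN _ _ _ (fun t => n.+2%:R * posX n.+1 (2 * s + beta - t))).
  apply: (@continuousM _ _ (fun=> n.+2%:R)); first exact: cst_continuous.
  apply: (@continuous_comp _ _ _ (fun t => 2 * s + beta - t) (posX n.+1)).
    by apply: continuousB; [exact: cst_continuous|exact: cvg_id].
  exact: posX_continuous.
have cf := C1_manifold_normsq dg cg'.
(* Outside [K (2 * s)] the base of the truncated power is negative, so the support lies in a set
   that properness makes compact. *)
have f0 p : ~ K (2 * s) p -> g (N p) = 0.
  move=> /negP; rewrite -ltNge => Np; rewrite /g /posX max_l ?expr0n//.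
  by rewrite subr_le0 ltW.
have hE : h s = (fun p => n%:R * g (N p) + radial (fun q => g (N q)) p).
  by apply/funext => p; rewrite radial_normsq.
split; last first.
  rewrite hE.
  exact: (div_field_integrable immersion_x hausdorff_S atlas_A vol_g cp_atlas
    mu_lebesgue cf (@compact_K (2 * s)) f0).
rewrite hE.
exact: (divergence_theorem immersion_x hausdorff_S atlas_A minimal_x vol_g
  cp_atlas mu_lebesgue cf (@compact_K (2 * s)) f0).
Qed.

Let v s := fine (vol (K s)).

Let vE s : vol (K s) = (v s)%:E.
Proof. by rewrite fineK// ge0_fin_numE// vol_K_lty. Qed.

Lemma volume_growth_step s : beta <= s -> 0 < s ->
  v (3 / 2 * s) <= (1 + n%:R * 8 ^+ n.+2) * v s.
Proof.
move=> bs s0; have [h0 ih] := h_integral s.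
have sub : K s `<=` K (3 / 2 * s) by move=> p; rewrite /K /=; lra.
have mE : measurable (E s : set (borel S)) by exact: measurableD.
have volE : vol (E s) = (v (3 / 2 * s) - v s)%:E.
  rewrite /E measureD//; last by rewrite vol_K_lty.
  rewrite (setIidr sub) EFinB; congr (_ - _)%E; exact: vE.
set M := n%:R * (4 * s) ^+ n.+2; set m := (s / 2) ^+ n.+2.
have ii (k : R) (D : set (borel S)) : measurable D -> (vol D < +oo)%E ->
    vol.-integrable setT (EFin \o (fun p => k * \1_D p)).
  move=> mD volD; apply: (@bounded_support_integrable R _ _ vol D `|k|) => //.
  - by apply: measurable_funM => //; exact: measurable_indic.
  - by move=> p Dp; rewrite indicE mem_set// mulr1.
  - by move=> p Dp; rewrite indicE memNset// mulr0.
have iK := ii M (K s) (measurable_K s) (vol_K_lty s).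
have iE : vol.-integrable setT (EFin \o (fun p => m * \1_(E s) p)).
  by apply: ii => //; rewrite volE ltry.
have intI (k : R) (D : set (borel S)) : measurable D -> 0 <= k ->
    (\int[vol]_p (k * \1_D p)%:E = k%:E * vol D)%E.
  move=> mD k0; under eq_integral do rewrite EFinM.
  rewrite ge0_integralZl//.
  - by rewrite integral_indic// setIT.
  - by apply/measurable_EFinP; exact: measurable_indic.
have M0 : 0 <= M by rewrite mulr_ge0 ?ler0n// exprn_ge0// mulr_ge0// ltW.
have m0 : 0 < m by rewrite exprn_gt0// divr_gt0.
(* As [h s] has integral zero, this becomes m (v (3 s / 2) - v s) <= M v s. *)
have : (\int[vol]_p (h s p)%:E <=
    \int[vol]_p (M * \1_(K s) p - m * \1_(E s) p)%:E)%E.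
  apply: le_integral => //; first exact: (integrableB _ iK iE).
  by move=> p _; rewrite lee_fin; exact: h_le.
rewrite h0; under eq_integral do rewrite EFinB.
rewrite integralB// (intI _ _ (measurable_K s) M0) (intI _ _ mE (ltW m0)) volE vE -!EFinM -EFinB lee_fin subr_ge0.
(* The 8 is the ratio of 4 s to s / 2. It does not depend on [s], which is what lets the estimate be
   iterated. *)
have -> : M = n%:R * 8 ^+ n.+2 * m.
  by rewrite -mulrA -exprMn; congr (_ * _ ^+ _); field.
have -> : n%:R * 8 ^+ n.+2 * m * v s = m * (n%:R * 8 ^+ n.+2 * v s) by ring.
by rewrite ler_pM2l// lerBlDl [X in _ -> _ <= X]mulrDl mul1r.
Qed.

Lemma volume_growth : polynomial_volume_growth x vol.
Proof.
(* From here on both [beta <= s] and [0 < s] hold, and [1 <= s0] as the iteration requires. *)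
pose s0 := 1 + beta.
have [||||s|d vd] := @polynomial_of_geometric R v (3 / 2) (1 + n%:R * 8 ^+ n.+2) s0.
- lra.
- move=> s t st; rewrite -lee_fin -!vE; apply: le_measure; rewrite ?inE//.
  by move=> p; rewrite /K /= => /le_trans; apply; rewrite lerD2r.
- by move=> s; rewrite fine_ge0.
- by rewrite lerDl.
- move=> ss; apply: volume_growth_step; first by apply: le_trans ss; rewrite lerDr.
  by apply: lt_le_trans ss; rewrite ltr_wpDr.
(* [v] is a function of a bound on |x|^2, so the radius enters as [r ^+ 2] and the exponent
   doubles. *)
exists ((3 / 2) ^+ d * v s0), (d.*2)%:R; split.
- by rewrite mulr_ge0 ?fine_ge0// exprn_ge0// divr_ge0.
- exact: ler0n.
near=> r; have r1 : 1 <= r by near: r; exact: nbhs_pinfty_ge.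
have r0 : 0 <= r by apply: le_trans r1.
have -> : [set q | enorm (x q) <= r] = K (r ^+ 2 - beta).
  apply/seteqP; split=> q; rewrite /K /= subrK;
    by rewrite -[N q]sqr_sqrtr ?dotp_ge0// ler_sqr// nnegrE sqrtr_ge0.
apply: (@le_trans _ _ (vol (K (r ^+ 2)))).
  apply: le_measure; rewrite ?inE//; move=> q; rewrite /K /= subrK => qr.
  by apply: le_trans qr _; rewrite lerDl.
rewrite vE lee_fin powR_mulrn// -muln2 mulnC exprM; apply: vd.
by rewrite exprn_ege1.
Unshelve. all: by end_near. Qed.

End VolumeGrowth.

Theorem corollary1p1 (R : realType) (n : nat) (S : ptopologicalType)
  (A : set (chart R n S)) (x : S -> 'rV[R]_n.+1)
  (vol : {measure set (g_sigma_algebraType (@open S)) -> \bar R})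
  (manifold_S : smooth_manifold A)
  (connected_S : connected [set: S])
  (orientable_S : orientable A)
  (immersion_x : smooth_immersion A x)
  (proper_x : proper_map x)
  (minimal_x : minimal A x)
  (bounded_perp : bounded_x_perp A x)
  (vol_g : volume_measure A x vol) :
  polynomial_volume_growth x vol.
Proof.
have [hausdorff_S _ atlas_A] := manifold_S.
have /choice[cp cp_atlas] : forall p : S, exists c, A c /\ chart_dom c p.
  by move=> p; have [c Ac cp] := atlas_A.1 p; exists c.
have [mu mu_lebesgue] := @exists_lebesgue_rV R n.
have [B perp_le] := bounded_perp.
apply: (volume_growth immersion_x hausdorff_S atlas_A minimal_x proper_x vol_g
  cp_atlas mu_lebesgue (beta := B ^+ 2)) => p.
have [Ap dp] := cp_atlas p; have := perp_le _ _ Ap dp; rewrite /enorm => xB.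
rewrite -[leLHS]sqr_sqrtr ?dotp_ge0// ler_sqr// nnegrE ?sqrtr_ge0//.
exact: le_trans (sqrtr_ge0 _) xB.
Qed.
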